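(* Let $X\in\mathbf{Top}$. For each integer $n\geq 1$, the canonical map $\|\Lambda_\bullet X\|_{n-1}\to X$ factors through the Ganea fibration $p_n\colon G_n(X)\to X$.
   Context: $\mathbf{Top}$ is the category of well-pointed compactly generated spaces having the homotopy type of CW-complexes. $\Omega$ and $\Sigma$ are the loop space and reduced suspension functors, and $\mathrm{ev}_X\colon\Sigma\Omega X\to X$, $[\omega,s]\mapsto\omega(s)$, is the evaluation map. Ganea fibrations: $p_1\colon G_1(X)\to X$ is the fibration associated to $\mathrm{ev}_X\colon\Sigma\Omega X\to X$. Given $p_n\colon G_n(X)\to X$ with homotopy fiber $F_n(X)$, let $G_n(X)\cup\mathcal{C}(F_n(X))$ be the mapping cone (with reduced cone $\mathcal C$) of $F_n(X)\to G_n(X)$ and let $p'_{n+1}\colon G_n(X)\cup\mathcal C(F_n(X))\to X$ be $p_n$ on $G_n(X)$ and constant at the base point on the cone; $p_{n+1}\colon G_{n+1}(X)\to X$ is the fibration associated to $p'_{n+1}$. A facial space $X_\bullet$ is a sequence of spaces $X_0,X_1,\dots$ in $\mathbf{Top}$ with maps $d_i\colon X_n\to X_{n-1}$ ($0\le i\le n$) such that $d_id_j=d_{j-1}d_i$ for $i<j$. A facial resolution $X_\bullet\to X$ is a facial space together with an augmentation $d_0\colon X_0\to X$ satisfying $d_0d_0=d_0d_1$ on $X_1$. Realization: let $\Delta^n$ be the standard $n$-simplex, $\delta^i$ the inclusions of its faces, and $X\rtimes Y=X\times Y/( *\times Y)$. Set $\|X_\bullet\|_0=X_0$ with $\chi_0\colon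 X_0\rtimes\Delta^0\to X_0$ the obvious homeomorphism. Inductively, $\|X_\bullet\|_n$ and $\chi_n\colon X_n\rtimes\Delta^n\to\|X_\bullet\|_n$ are defined by the pushout of $X_n\rtimes\Delta^n\hookleftarrow X_n\rtimes\partial\Delta^n\xrightarrow{\varphi_n}\|X_\bullet\|_{n-1}$, where $\varphi_n\circ(X_n\rtimes\delta^i)=\chi_{n-1}\circ(d_i\rtimes\Delta^{n-1})$ for $0\le i\le n$. For a facial resolution $X_\bullet\to X$, the canonical map $\|X_\bullet\|_n\to X$ is the augmentation for $n=0$; for $n\geq 1$ it is the unique map extending the canonical map on $\|X_\bullet\|_{n-1}$ whose composite with $\chi_n$ is $X_n\rtimes\Delta^n\xrightarrow{\mathrm{pr}}X_n\xrightarrow{(d_0)^{n+1}}X$. $\Lambda_\bullet X\to X$ is the facial resolution with $\Lambda_nX=(\Sigma\Omega)^{n+1}X$, face operators $d_i=(\Sigma\Omega)^i(\mathrm{ev}_{(\Sigma\Omega)^{n-i}X})\colon(\Sigma\Omega)^{n+1}X\to(\Sigma\Omega)^nX$, and augmentation $d_0=\mathrm{ev}_X\colon\Sigma\Omega X\to X$. *)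

(* Defs.v *)
From HB Require Import structures.
From mathcomp Require Import all_boot all_order all_algebra generic_quotient.
From mathcomp Require Import all_classical all_reals all_analysis.
From Stdlib Require Import Relation_Operators.
Import numFieldNormedType.Exports.
Import Order.TTheory GRing.Theory Num.Theory.

Set Implicit Arguments.
Unset Strict Implicit.
Unset Printing Implicit Defensive.

Local Open Scope classical_set_scope.
Local Open Scope ring_scope.
Local Open Scope quotient_scope.

Definition kopen (T : topologicalType) (U : set T) : Prop :=
  forall (K : topologicalType) (f : K -> T),
    compact [set: K] -> hausdorff_space K -> continuous f -> open (f @^-1` U).

(** [compactly_generated] means that [T] has the final topology for the maps
    from compact Hausdorff spaces; no (weak) Hausdorff axiom is imposed. *)
Definition compactly_generated (T : topologicalType) : Prop :=
  forall U : set T, kopen U -> open U.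

(** [kify T] is [T] with the compactly generated topology whose open sets are
    the [kopen] sets.  It is applied to every product, subspace and function
    space; quotients and disjoint unions do not need it. *)
Definition kify (T : Type) : Type := T.

Section Kify.
Variable T : topologicalType.

HB.instance Definition _ := Choice.on (kify T).

Let kopenT : @kopen T [set: T].
Proof. by move=> K f _ _ _; rewrite preimage_setT; exact: openT. Qed.

Let kopenI : setI_closed (@kopen T).
Proof.
by move=> U V kU kV K f *; rewrite preimage_setI; apply: openI;
  [exact: kU|exact: kV].
Qed.

Let kopen_bigU (I : Type) (F : I -> set T) :
  (forall i, @kopen T (F i)) -> @kopen T (\bigcup_i F i).
Proof.
move=> kF K f *; rewrite preimage_bigcup.
by apply: bigcup_open => i _; exact: kF.
Qed.

HB.instance Definition _ :=
  @isOpenTopological.Build (kify T) (@kopen T) kopenT kopenI kopen_bigU.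

Lemma kify_openE : @open (kify T) = @kopen T.
Proof. by []. Qed.

Lemma from_kify_continuous : continuous (id : kify T -> T).
Proof.
apply/continuousP => U oU; rewrite kify_openE.
by move=> K f _ _ /continuousP; exact.
Qed.

Lemma to_kify_continuous (K : topologicalType) (f : K -> T) :
  compactly_generated K -> continuous f -> continuous (f : K -> kify T).
Proof.
move=> cK cf; apply/continuousP => U; rewrite kify_openE => kU; apply: cK => L g cL hL cg.
apply: (kU L (f \o g)) => // x; apply: continuous_comp; [exact: cg|exact: cf].
Qed.

Lemma compact_hausdorff_cg (K : topologicalType) :
  compact [set: K] -> hausdorff_space K -> compactly_generated K.
Proof. by move=> cK hK U /(_ K id cK hK); apply => x U'. Qed.

Lemma kify_cg : compactly_generated (kify T).
Proof.
move=> U kU; rewrite kify_openE => K f cK hK cf; apply: (kU K f) => //.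
apply: to_kify_continuous => //; exact: compact_hausdorff_cg.
Qed.

End Kify.

Lemma kify_map_continuous (S T : topologicalType) (f : S -> T) :
  continuous f -> continuous (f : kify S -> kify T).
Proof.
move=> cf; apply: to_kify_continuous; first exact: kify_cg.
move=> x; apply: (@continuous_comp (kify S) S T id f); last exact: cf.
exact: from_kify_continuous.
Qed.

Lemma kify_out_continuous (S T : topologicalType) (f : S -> T) :
  continuous f -> continuous (f : kify S -> T).
Proof.
move=> cf x; apply: (@continuous_comp (kify S) S T id f); last exact: cf.
exact: from_kify_continuous.
Qed.

Record cgSpace := CGSpace {
  cg_top :> topologicalType;
  cg_pt : cg_top;
  cg_gen : compactly_generated cg_top }.

Arguments cg_pt : clear implicits.

Lemma id_cont (T : topologicalType) : continuous (@id T).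
Proof. by move=> x U. Qed.

Record cgMap (X Y : cgSpace) := PMap {
  pfun :> X -> Y;
  cgmap_cont : continuous pfun;
  cgmap_pt : pfun (cg_pt X) = cg_pt Y }.

Definition pid (X : cgSpace) : cgMap X X :=
  @PMap X X id (@id_cont X) (erefl _).

Lemma pcomp_cont (X Y Z : cgSpace) (g : cgMap Y Z) (f : cgMap X Y) :
  continuous (g \o f).
Proof. by move=> x; apply: continuous_comp; exact: cgmap_cont. Qed.

Lemma pcomp_pt (X Y Z : cgSpace) (g : cgMap Y Z) (f : cgMap X Y) :
  (g \o f) (cg_pt X) = cg_pt Z.
Proof. by rewrite /= !cgmap_pt. Qed.

Definition pcomp (X Y Z : cgSpace) (g : cgMap Y Z) (f : cgMap X Y) : cgMap X Z :=
  PMap (@pcomp_cont X Y Z g f) (pcomp_pt g f).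

Definition pcst (X Y : cgSpace) : cgMap X Y :=
  @PMap X Y (fun=> cg_pt Y) (@cst_continuous X Y (cg_pt Y)) (erefl _).

Definition kprod (X Y : topologicalType) : topologicalType :=
  kify (X * Y)%type.

Definition kuncurry (X Y : topologicalType) (Z : Type) (f : X -> Y -> Z) :
  kprod X Y -> Z := fun p => f p.1 p.2.

Definition ksub (X : topologicalType) (A : set X) : topologicalType :=
  kify (set_type A).

Section Ksub.
Variables (X : topologicalType) (A : set X).

Definition ksub_val (x : ksub A) : X := set_val (x : set_type A).
Definition ksub_in (x : X) (Ax : A x) : ksub A := SigSub (mem_set Ax) : set_type A.

Lemma ksub_valP (x : ksub A) : A (ksub_val x).
Proof. exact: set_valP. Qed.

Lemma ksub_val_inj : injective ksub_val.
Proof. exact: val_inj. Qed.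

Lemma ksub_val_continuous : continuous ksub_val.
Proof. apply: kify_out_continuous; exact: initial_continuous. Qed.

Lemma ksub_in_continuous (K : topologicalType) (f : K -> X)
    (Af : forall k, A (f k)) :
  compactly_generated K -> continuous f ->
  continuous (fun k => ksub_in (Af k)).
Proof.
move=> cK cf; apply: to_kify_continuous => //.
apply: continuous_comp_initial; exact: cf.
Qed.

Definition ksub_space (a : X) (Aa : A a) : cgSpace :=
  @CGSpace (ksub A) (ksub_in Aa) (@kify_cg _).

End Ksub.

Section Glue.
Variables (T : topologicalType) (r : T -> T -> Prop).

Definition glue_relb : rel T := fun x y => `[< clos_refl_sym_trans T r x y >].

Lemma glue_refl : reflexive glue_relb.
Proof. by move=> x; apply/asboolP; exact: rst_refl. Qed.

Lemma glue_sym : symmetric glue_relb.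
Proof.
by move=> x y; apply/idP/idP => /asboolP h; apply/asboolP; exact: rst_sym.
Qed.

Lemma glue_trans : transitive glue_relb.
Proof.
move=> y x z /asboolP xy /asboolP yz; apply/asboolP; exact: rst_trans xy yz.
Qed.

Definition glue_equiv := EquivRel glue_relb glue_refl glue_sym glue_trans.

(** The quotient space of [T] by the equivalence relation generated by [r]. *)
Definition glue : topologicalType := quotient_topology {eq_quot glue_equiv}.

Definition glue_pi (x : T) : glue := \pi_({eq_quot glue_equiv}) x.

Lemma glue_pi_continuous : continuous glue_pi.
Proof. exact: (@pi_continuous T {eq_quot glue_equiv}). Qed.

Lemma glue_pi_surj (q : glue) : exists x, glue_pi x = q.
Proof. by exists (repr (q : {eq_quot glue_equiv})); exact: reprK. Qed.

Lemma glue_pi_eq x y : r x y -> glue_pi x = glue_pi y.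
Proof. by move=> rxy; apply/eqmodP/asboolP; exact: rst_step. Qed.

Lemma glue_cg : compactly_generated T -> compactly_generated glue.
Proof.
move=> cT U kU; apply: cT => K f cK hK cf; apply: (kU K (glue_pi \o f)) => //.
by move=> x; apply: continuous_comp; [exact: cf|exact: glue_pi_continuous].
Qed.

Definition glue_rec (Z : Type) (f : T -> Z) (q : glue) : Z :=
  f (repr (q : {eq_quot glue_equiv})).

Lemma glue_recE (Z : Type) (f : T -> Z) :
  (forall x y, r x y -> f x = f y) -> forall x, glue_rec f (glue_pi x) = f x.
Proof.
move=> fr x; rewrite /glue_rec /glue_pi.
have fE a b : clos_refl_sym_trans T r a b -> f a = f b.
  by elim => [{}a {}b /fr|//|{}a {}b _ ->//|{}a {}b c _ -> _ ->].
apply/fE/asboolP; have := reprK (\pi_({eq_quot glue_equiv}) x).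
by move/eqmodP.
Qed.

Lemma glue_rec_continuous (Z : topologicalType) (f : T -> Z) :
  (forall x y, r x y -> f x = f y) -> continuous f -> continuous (glue_rec f).
Proof.
move=> fr cf; apply/(@quotient_continuous T {eq_quot glue_equiv}).
rewrite (_ : _ \o _ = f) //; apply/funext => x; exact: glue_recE.
Qed.

End Glue.

(** [prod_mod A a] is [(X * Y) / A], based at the class of [a]; it is only used
    with [A a], so that the base point is the class of [A]. *)
Section ProdMod.
Variables (X Y : topologicalType) (A : set (X * Y)%type) (a : (X * Y)%type).

Definition collapse_rel (x y : kprod X Y) : Prop := A x /\ A y.

Definition prod_mod : cgSpace :=
  @CGSpace (glue collapse_rel) (glue_pi collapse_rel a)
    (glue_cg (@kify_cg _)).

Definition prod_pi (x : X) (y : Y) : prod_mod := glue_pi collapse_rel (x, y).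

Lemma prod_pi_continuous :
  continuous (kuncurry prod_pi).
Proof.
rewrite (_ : kuncurry _ = glue_pi collapse_rel); last by apply/funext => -[].
exact: glue_pi_continuous.
Qed.

Lemma prod_pi_surj (q : prod_mod) : exists x y, prod_pi x y = q.
Proof. by have [[x y] <-] := glue_pi_surj q; exists x, y. Qed.

Section Rec.
Variables (Z : cgSpace) (f : X -> Y -> Z).
Hypothesis fA : forall p, A p -> f p.1 p.2 = cg_pt Z.
Hypothesis fa : f a.1 a.2 = cg_pt Z.
Hypothesis cf : continuous (kuncurry f).

Definition prod_mod_fun : prod_mod -> Z := glue_rec (kuncurry f).

Lemma prod_mod_compat (p q : kprod X Y) :
  collapse_rel p q -> kuncurry f p = kuncurry f q.
Proof. by move=> [Ap Aq]; rewrite /kuncurry !fA. Qed.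

Lemma prod_mod_recE x y : prod_mod_fun (prod_pi x y) = f x y.
Proof. by rewrite /prod_mod_fun /prod_pi (glue_recE prod_mod_compat). Qed.

Lemma prod_mod_cont : continuous prod_mod_fun.
Proof. by apply: glue_rec_continuous => //; exact: prod_mod_compat. Qed.

Lemma prod_mod_pt : prod_mod_fun (cg_pt prod_mod) = cg_pt Z.
Proof. by rewrite /prod_mod_fun /= (glue_recE prod_mod_compat). Qed.

Definition prod_mod_rec : cgMap prod_mod Z := PMap prod_mod_cont prod_mod_pt.

End Rec.
End ProdMod.

Lemma kprod_map_continuous (X Y X' Y' : topologicalType) (f : X -> X')
    (g : Y -> Y') :
  continuous f -> continuous g ->
  continuous ((fun p => (f p.1, g p.2)) : kprod X Y -> kprod X' Y').
Proof.
move=> cf cg; apply: kify_map_continuous => -[x y] /=.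
apply: cvg_pair => /=.
- by apply: cvg_comp; [exact: cvg_fst|exact: cf].
- by apply: cvg_comp; [exact: cvg_snd|exact: cg].
Qed.

Section ProdModMap.
Variables (X Y X' Y' : topologicalType).
Variables (A : set (X * Y)%type) (a : (X * Y)%type).
Variables (A' : set (X' * Y')%type) (a' : (X' * Y')%type) (Aa' : A' a').
Variables (f : X -> X') (g : Y -> Y').
Hypotheses (cf : continuous f) (cg : continuous g).
Hypothesis AA' : forall p, A p -> A' (f p.1, g p.2).
Hypothesis Aa : A a.

Lemma prod_mod_map_compat p :
  A p -> prod_pi A' a' (f p.1) (g p.2) = cg_pt (prod_mod A' a').
Proof. by move=> Ap; apply: glue_pi_eq; split => //; exact: AA'. Qed.

Lemma prod_mod_map_cont :
  continuous (kuncurry (fun x y => prod_pi A' a' (f x) (g y))).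
Proof.
move=> p.
apply: (@continuous_comp (kprod X Y) (kprod X' Y') _
  (fun p => (f p.1, g p.2)) (kuncurry (prod_pi A' a'))).
- exact: kprod_map_continuous.
- exact: prod_pi_continuous.
Qed.

Definition prod_mod_map : cgMap (prod_mod A a) (prod_mod A' a') :=
  prod_mod_rec prod_mod_map_compat (prod_mod_map_compat Aa) prod_mod_map_cont.

Lemma prod_mod_mapE x y :
  prod_mod_map (prod_pi A a x y) = prod_pi A' a' (f x) (g y).
Proof. exact: prod_mod_recE prod_mod_map_compat x y. Qed.

End ProdModMap.

Section Coprod.
Variables A B : topologicalType.

Definition coprod_fam (b : bool) : topologicalType := if b then A else B.
Definition coprod : topologicalType := {b : bool & coprod_fam b}.
Definition in1 (a : A) : coprod := existT coprod_fam true a.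
Definition in2 (b : B) : coprod := existT coprod_fam false b.

Definition copair (Z : Type) (f : A -> Z) (g : B -> Z) (x : coprod) : Z :=
  match x with
  | existT b y =>
    (if b return coprod_fam b -> Z then f else g) y
  end.

Lemma in1_continuous : continuous in1.
Proof. exact: (@existT_continuous bool coprod_fam true). Qed.

Lemma in2_continuous : continuous in2.
Proof. exact: (@existT_continuous bool coprod_fam false). Qed.

Lemma copair_continuous (Z : topologicalType) (f : A -> Z) (g : B -> Z) :
  continuous f -> continuous g -> continuous (copair f g).
Proof.
move=> cf cg; apply/continuousP => U oU; apply/sigT_openP.
by case; [move/continuousP: cf|move/continuousP: cg]; exact.
Qed.

Lemma coprod_cg :
  compactly_generated A -> compactly_generated B -> compactly_generated coprod.
Proof.
move=> cA cB U kU; apply/sigT_openP; case.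
- apply: cA => K f cK hK cf; apply: (kU K (in1 \o f)) => //.
  by move=> x; apply: continuous_comp; [exact: cf|exact: in1_continuous].
- apply: cB => K f cK hK cf; apply: (kU K (in2 \o f)) => //.
  by move=> x; apply: continuous_comp; [exact: cf|exact: in2_continuous].
Qed.

End Coprod.

(** The pushout of [A <-f- C -g-> B].  Its topology does not involve the one of
    [C], so [C] may be a bare type. *)
Section Pushout.
Variables (A B : cgSpace) (C : Type) (f : C -> A) (g : C -> B).

Definition pushout_rel (x y : coprod A B) : Prop :=
  exists c, x = in1 B (f c) /\ y = in2 A (g c).

Definition po1 (a : A) : glue pushout_rel := glue_pi _ (in1 B a).
Definition po2 (b : B) : glue pushout_rel := glue_pi _ (in2 A b).

Definition pushout : cgSpace :=
  @CGSpace (glue pushout_rel) (po1 (cg_pt A))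
    (glue_cg (coprod_cg (@cg_gen A) (@cg_gen B))).

Lemma po1_continuous : continuous po1.
Proof.
move=> x; apply: (@continuous_comp _ (coprod A B) _ (@in1 A B)).
  exact: in1_continuous.
exact: glue_pi_continuous.
Qed.

Lemma po2_continuous : continuous po2.
Proof.
move=> x; apply: (@continuous_comp _ (coprod A B) _ (@in2 A B)).
  exact: in2_continuous.
exact: glue_pi_continuous.
Qed.

Lemma po_glue c : po1 (f c) = po2 (g c).
Proof. by apply: glue_pi_eq; exists c. Qed.

Definition pushout_in1 : cgMap A pushout := @PMap A pushout po1 po1_continuous
  (erefl _).

Lemma po2_pt (c0 : C) : f c0 = cg_pt A -> g c0 = cg_pt B ->
  po2 (cg_pt B) = po1 (cg_pt A).
Proof. by move=> <- <-; rewrite po_glue. Qed.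

Definition pushout_in2 (c0 : C) (fc0 : f c0 = cg_pt A) (gc0 : g c0 = cg_pt B) :
    cgMap B pushout :=
  @PMap B pushout po2 po2_continuous (po2_pt fc0 gc0).

Section Rec.
Variables (Z : cgSpace) (u : cgMap A Z) (v : cgMap B Z).
Hypothesis uv : forall c, u (f c) = v (g c).

Lemma pushout_compat x y : pushout_rel x y -> copair u v x = copair u v y.
Proof. by case=> c [-> ->]; exact: uv. Qed.

Lemma pushout_rec_cont :
  continuous (glue_rec (copair u v) : pushout -> Z).
Proof.
apply: glue_rec_continuous; first exact: pushout_compat.
by apply: copair_continuous; exact: cgmap_cont.
Qed.

Lemma pushout_rec1 a : glue_rec (copair u v) (po1 a) = u a.
Proof. by rewrite /po1 (glue_recE pushout_compat). Qed.

Lemma pushout_rec2 b : glue_rec (copair u v) (po2 b) = v b.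
Proof. by rewrite /po2 (glue_recE pushout_compat). Qed.

Lemma pushout_rec_pt : glue_rec (copair u v) (cg_pt pushout) = cg_pt Z.
Proof. by rewrite pushout_rec1 cgmap_pt. Qed.

Definition pushout_rec : cgMap pushout Z := PMap pushout_rec_cont pushout_rec_pt.

End Rec.
End Pushout.

Lemma set_type_compact (T : topologicalType) (A : set T) :
  compact A -> compact [set: set_type A].
Proof.
move=> cA F PF _.
have [] := cA (set_val @ F).
  by apply: (@filterS _ F _ [set: set_type A]) => [x _|]; [exact: set_valP|exact: filterT].
move=> p [Ap clp]; exists (SigSub (mem_set Ap) : set_type A); split => // B C FB.
case=> _ [[W oW <-] /= Wp WC].
have [] := clp (set_val @` B) W.
- by apply: (@filterS _ F _ B) => // x Bx; exists x.
- exact: open_nbhs_nbhs.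
by move=> _ [[x Bx <-] Wx]; exists x; split => //; exact: WC.
Qed.

Lemma set_type_hausdorff (T : topologicalType) (A : set T) :
  hausdorff_space T -> hausdorff_space (set_type A).
Proof.
move=> hT x y clxy; apply: val_inj; apply: hT => U V nU nV.
have ct : continuous (set_val : set_type A -> T).
  exact: initial_continuous.
have [z [Uz Vz]] := clxy _ _ (ct x U nU) (ct y V nV).
by exists (set_val z).
Qed.

Section Constructions.
Variable R : realType.

Definition unitI : topologicalType :=
  set_type (`[0, 1]%classic : set R).

Lemma unitI_proof (r : R) : 0 <= r <= 1 -> `[0, 1]%classic r.
Proof. by rewrite /= in_itv. Qed.

Definition I0 : unitI := SigSub (mem_set (@unitI_proof 0 ltac:(by rewrite lexx ler01))).
Definition I1 : unitI := SigSub (mem_set (@unitI_proof 1 ltac:(by rewrite lexx ler01))).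

Lemma unitI_compact : compact [set: unitI].
Proof. apply: set_type_compact; exact: segment_compact. Qed.

Lemma unitI_hausdorff : hausdorff_space unitI.
Proof. apply: set_type_hausdorff; exact: Rhausdorff. Qed.

Definition paths_co (X : topologicalType) : topologicalType :=
  initial_topology
    (fun w : continuousType unitI X => (w : {compact-open, unitI -> X})).

Definition paths (X : topologicalType) : topologicalType := kify (paths_co X).

Definition path_at (X : topologicalType) (w : paths X) : unitI -> X :=
  (w : continuousType unitI X).

Lemma path_at_continuous (X : topologicalType) :
  continuous ((fun p => path_at p.1 p.2) : (paths_co X * unitI)%type -> X).
Proof.
rewrite (_ : (fun p => _) =
  uncurry (fun w : paths_co X => path_at w)); last by apply/funext => -[].
apply: continuous_uncurry.
- move=> x _; exists [set: unitI]; first by rewrite withinET; exact: filterT.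
  by split; [exact: unitI_compact|exact: closedT].
- exact: unitI_hausdorff.
- exact: initial_continuous.
- by move=> w; exact: (@cts_fun _ _ (w : continuousType unitI X)).
Qed.

Lemma path_at_kcontinuous (X : topologicalType) :
  continuous (kuncurry (@path_at X)).
Proof.
move=> p.
apply: (@continuous_comp (kprod (paths X) unitI) (paths_co X * unitI)%type X
  id (fun p => path_at p.1 p.2)); last exact: path_at_continuous.
case: p => w s U /= [[V W] [/= nV nW] VWU].
apply: (@from_kify_continuous (paths X * unitI)%type (w, s)).
exists (V, W) => //; split => //; exact: (@from_kify_continuous (paths_co X) w).
Qed.

Lemma path_at_pt_continuous (X : topologicalType) (s : unitI) :
  continuous ((fun w => path_at w s) : paths X -> X).
Proof.
apply: (@kify_out_continuous (paths_co X) X) => w.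
apply: (@continuous_comp (paths_co X) (paths_co X * unitI)%type X
  (fun w => (w, s)) (fun p => path_at p.1 p.2)); last exact: path_at_continuous.
move=> U [[V W] [/= nV nW] VWU]; apply: filterS nV => v Vv; apply: VWU.
by split => //; exact: nbhs_singleton.
Qed.

Definition mkpath (X : topologicalType) (w : unitI -> X) (cw : continuous w) :
  paths X := (mkcts cw : continuousType unitI X).

Lemma path_cont (X : topologicalType) (w : paths X) : continuous (path_at w).
Proof. exact: (@cts_fun _ _ (w : continuousType unitI X)). Qed.

Lemma path_map_subproof (X Y : topologicalType) (f : X -> Y) (w : paths X) :
  continuous f -> continuous (f \o path_at w).
Proof.
by move=> cf x; apply: continuous_comp; [exact: path_cont|exact: cf].
Qed.

Definition path_map (X Y : topologicalType) (f : X -> Y) (cf : continuous f)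
  (w : paths X) : paths Y := mkpath (@path_map_subproof X Y f w cf).

Lemma path_map_continuous (X Y : topologicalType) (f : X -> Y)
  (cf : continuous f) : continuous (path_map cf).
Proof.
apply: (@kify_map_continuous (paths_co X) (paths_co Y)).
apply: continuous_comp_initial => w.
apply/compact_open_cvgP; first by apply: fmap_filter; exact: nbhs_filter.
move=> K O cK oO wKO.
have /= := @initial_continuous (continuousType unitI X)
  {compact-open, unitI -> X} (fun w => w) w [set g | g @` K `<=` f @^-1` O].
rewrite nbhs_simpl/=.
move=> H; apply: filterS (H _).
- by move=> g /= gK _ [k Kk <-]; apply: gK; exists k.
- apply: open_nbhs_nbhs; split.
    by apply: compact_open_open => //; exact: open_comp.
  by move=> _ [k Kk <-]; apply: wKO; exists k.
Qed.

Definition cst_path (X : topologicalType) (x : X) : paths X :=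
  mkpath (@cst_continuous unitI X x).

(** [loop X] is a [ksub] of [paths X], so its elements are continuous maps
    [unitI -> X] with the [kify]-ed compact-open topology. *)
Definition loop_set (X : cgSpace) : set (paths X) :=
  [set w | path_at w I0 = cg_pt X /\ path_at w I1 = cg_pt X].

Lemma loop_set_cst (X : cgSpace) : loop_set (cst_path (cg_pt X)).
Proof. by []. Qed.

Definition loop (X : cgSpace) : cgSpace := ksub_space (loop_set_cst X).

Definition loop_at (X : cgSpace) (w : loop X) : unitI -> X :=
  path_at (ksub_val w).

Lemma loop_map_subproof (X Y : cgSpace) (f : cgMap X Y) (w : loop X) :
  loop_set (path_map (@cgmap_cont _ _ f) (ksub_val w)).
Proof.
have [w0 w1] := ksub_valP w.
split; first by rewrite -[LHS]/(f (path_at (ksub_val w) I0)) w0 cgmap_pt.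
by rewrite -[LHS]/(f (path_at (ksub_val w) I1)) w1 cgmap_pt.
Qed.

Lemma loop_map_cont (X Y : cgSpace) (f : cgMap X Y) :
  continuous ((fun w => ksub_in (loop_map_subproof f w)) : loop X -> loop Y).
Proof.
apply: ksub_in_continuous; first exact: kify_cg.
move=> w; apply: (@continuous_comp (loop X) (paths X) _ (@ksub_val _ _)).
- exact: ksub_val_continuous.
- exact: path_map_continuous.
Qed.

Lemma loop_map_pt (X Y : cgSpace) (f : cgMap X Y) :
  ksub_in (loop_map_subproof f (cg_pt (loop X))) = cg_pt (loop Y).
Proof.
apply: ksub_val_inj; apply/continuousEP => s /=; exact: cgmap_pt.
Qed.

Definition loop_map (X Y : cgSpace) (f : cgMap X Y) :
  cgMap (loop X) (loop Y) := PMap (@loop_map_cont X Y f) (loop_map_pt f).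

Definition susp_set (X : cgSpace) : set (X * unitI)%type :=
  [set p | [\/ p.1 = cg_pt X, p.2 = I0 | p.2 = I1]].

(** [prod_pi (susp_set X) (cg_pt X, I0) x s] is the class [[x, s]]. *)
Definition susp (X : cgSpace) : cgSpace :=
  prod_mod (@susp_set X) (cg_pt X, I0).

Section SuspMap.
Variables (X Y : cgSpace) (f : cgMap X Y).

Let susp_map_set (p : (X * unitI)%type) :
  susp_set p -> susp_set (f p.1, p.2).
Proof.
case: p => x s [/= ->|/= ->|/= ->].
- by apply: Or31; exact: cgmap_pt.
- exact: Or32.
- exact: Or33.
Qed.

Definition susp_map : cgMap (susp X) (susp Y) :=
  prod_mod_map (Or31 _ _ erefl : susp_set (cg_pt Y, I0)) (@cgmap_cont _ _ f)
    (@id_cont unitI) susp_map_set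
    (Or31 _ _ erefl : susp_set (cg_pt X, I0)).

End SuspMap.

Lemma ev_compat (X : cgSpace) (p : loop X * unitI) :
  susp_set p -> loop_at p.1 p.2 = cg_pt X.
Proof.
by case: p => w s [/= ->|/= ->|/= ->] //; have [] := ksub_valP w.
Qed.

Lemma ev_cont (X : cgSpace) : continuous (kuncurry (@loop_at X)).
Proof.
move=> p; apply: (@continuous_comp (kprod (loop X) unitI)
  (kprod (paths X) unitI) X (fun p => (ksub_val p.1, p.2))
  (kuncurry (@path_at X))).
  exact: (kprod_map_continuous (@ksub_val_continuous _ _) (@id_cont _)).
exact: path_at_kcontinuous.
Qed.

Definition ev (X : cgSpace) : cgMap (susp (loop X)) X :=
  prod_mod_rec (@ev_compat X) (@ev_compat X (cg_pt (loop X), I0)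
    (Or31 _ _ erefl)) (@ev_cont X).

Lemma ev_E (X : cgSpace) (w : loop X) (s : unitI) :
  ev X (prod_pi _ _ w s) = loop_at w s.
Proof. exact: (@prod_mod_recE _ _ _ _ _ _ (@ev_compat X)). Qed.

(** [so] is the functor [Sigma Omega]. *)
Definition so (X : cgSpace) : cgSpace := susp (loop X).

Definition so_map (X Y : cgSpace) (f : cgMap X Y) : cgMap (so X) (so Y) :=
  susp_map (loop_map f).

Lemma so_mapE (X Y : cgSpace) (f : cgMap X Y) (w : loop X) (s : unitI) :
  so_map f (prod_pi _ _ w s) = prod_pi _ _ (loop_map f w) s.
Proof. exact: prod_mod_mapE. Qed.

Lemma so_map_ev (X Y : cgSpace) (f : cgMap X Y) (x : so X) :
  ev Y (so_map f x) = f (ev X x).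
Proof.
by have [w [s <-]] := prod_pi_surj x; rewrite so_mapE !ev_E.
Qed.

Lemma so_map_comp (X Y Y' Z : cgSpace) (f : cgMap X Y) (g : cgMap Y Z)
    (f' : cgMap X Y') (g' : cgMap Y' Z) :
  (forall x, g (f x) = g' (f' x)) ->
  forall x, so_map g (so_map f x) = so_map g' (so_map f' x).
Proof.
move=> gf x; have [w [s <-]] := prod_pi_surj x; rewrite !so_mapE.
congr (prod_pi _ _ _ s); apply: ksub_val_inj; apply/continuousEP => t.
exact: gf.
Qed.

Fixpoint so_iter (X : cgSpace) (n : nat) : cgSpace :=
  if n is n'.+1 then so (so_iter X n') else X.

(** [so_face X n i] is [(SigmaOmega)^i (ev)] on [(SigmaOmega)^(n - i) X], for
    [i <= n]; the value for [n < i] is irrelevant. *)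
Fixpoint so_face (X : cgSpace) (n i : nat) {struct n} :
    cgMap (so_iter X n.+1) (so_iter X n) :=
  match i, n with
  | i'.+1, n'.+1 => so_map (so_face X n' i')
  | _, n => ev (so_iter X n)
  end.

Lemma so_faceK (X : cgSpace) (n i j : nat) : (i <= j <= n)%N ->
  forall x, so_face X n i (so_face X n.+1 j.+1 x) =
            so_face X n j (so_face X n.+1 i x).
Proof.
elim: n i j => [|n IH] [|i] j // /andP[ij jn] x.
- exact: so_map_ev.
- by case: j ij jn.
- exact: so_map_ev.
- case: j ij jn => // j ij jn.
  by apply: so_map_comp; apply: IH; apply/andP.
Qed.

Definition simplex_set (n : nat) : set 'rV[R]_n.+1 :=
  [set t | (forall i, 0 <= t ord0 i) /\ \sum_i t ord0 i = 1].

Definition simplex (n : nat) : topologicalType := set_type (@simplex_set n).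

Lemma vertex_proof (n : nat) : simplex_set (delta_mx ord0 (@ord0 n)).
Proof.
split=> [i|]; first by rewrite mxE ler0n.
rewrite (bigD1 ord0) //= big1 ?addr0 ?mxE ?eqxx // => i i0.
by rewrite mxE (negbTE i0) andbF.
Qed.

Definition vertex (n : nat) : simplex n := SigSub (mem_set (@vertex_proof n)).

Definition coface_mx (n : nat) (i : 'I_n.+2) (t : 'rV[R]_n.+1) : 'rV[R]_n.+2 :=
  \row_j oapp (t ord0) 0 (unlift i j).

Lemma coface_proof (n : nat) (i : 'I_n.+2) (t : simplex n) :
  simplex_set (coface_mx i (set_val t)).
Proof.
have [t0 t1] := set_valP t; split=> [j|].
  by rewrite mxE; case: unliftP => [k _|_] /=.
rewrite -t1 (bigD1_ord i) //= mxE unlift_none /= add0r.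
by apply: eq_bigr => k _; rewrite mxE liftK.
Qed.

Definition coface (n : nat) (i : 'I_n.+2) (t : simplex n) : simplex n.+1 :=
  SigSub (mem_set (coface_proof i t)).

Lemma coface_continuous (n : nat) (i : 'I_n.+2) : continuous (coface i).
Proof.
have cmx : continuous (coface_mx i : 'rV[R]_n.+1 -> 'rV[R]_n.+2).
  move=> t U [P nP PU]; exists (fun a b => P a (lift i b)) => [a b|M MP].
    by have := nP a (lift i b); rewrite mxE liftK /= (ord1 a).
  apply: PU => a b; rewrite mxE; case: unliftP => [k ->|->] /=.
    by have := MP a k; rewrite (ord1 a).
  by apply: nbhs_singleton; have := nP a i; rewrite mxE unlift_none.
apply: continuous_comp_initial => t.
apply: (@continuous_comp _ 'rV[R]_n.+1 _ set_val (coface_mx i)); last exact: cmx.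
exact: initial_continuous.
Qed.

(** [hsmash X y] is the half-smash of [X] and [Y], i.e. [X * Y] with
    [{cg_pt X} * Y] collapsed to the base point; [y] only serves to name it. *)
Definition hsmash_set (X : cgSpace) (Y : topologicalType) : set (X * Y)%type :=
  [set p | p.1 = cg_pt X].

Definition hsmash (X : cgSpace) (Y : topologicalType) (y : Y) : cgSpace :=
  prod_mod (@hsmash_set X Y) (cg_pt X, y).

Section HsmashMap.
Variables (X X' : cgSpace) (Y Y' : topologicalType) (y : Y) (y' : Y').
Variables (f : cgMap X X') (g : Y -> Y') (cg : continuous g).

Let hsmash_map_set (p : (X * Y)%type) :
  hsmash_set p -> hsmash_set (f p.1, g p.2).
Proof. by move=> /= ->; exact: cgmap_pt. Qed.

Definition hsmash_map : cgMap (hsmash X y) (hsmash X' y') :=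
  prod_mod_map (erefl : hsmash_set (cg_pt X', y')) (@cgmap_cont _ _ f) cg
    hsmash_map_set (erefl : hsmash_set (cg_pt X, y)).

End HsmashMap.

Lemma hsmash_pr_cont (X : cgSpace) (Y : topologicalType) :
  continuous (kuncurry (fun (x : X) (_ : Y) => x)).
Proof. apply: (@kify_out_continuous (X * Y)%type X fst) => p; exact: cvg_fst. Qed.

Definition hsmash_pr (X : cgSpace) (Y : topologicalType) (y : Y) :
    cgMap (hsmash X y) X :=
  @prod_mod_rec X Y (@hsmash_set X Y) (cg_pt X, y) X (fun x _ => x)
    (fun _ h => h) erefl (@hsmash_pr_cont X Y).

Lemma hsmash_prE (X : cgSpace) (Y : topologicalType) (y : Y) (x : X) (t : Y) :
  hsmash_pr X y (prod_pi (@hsmash_set X Y) (cg_pt X, y) x t) = x.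
Proof. exact: (@prod_mod_recE X Y (@hsmash_set X Y) _ X (fun x _ => x)). Qed.

Lemma hsmash_map_pr (X X' : cgSpace) (Y Y' : topologicalType) (y : Y) (y' : Y')
    (f : cgMap X X') (g : Y -> Y') (cg : continuous g) (z : hsmash X y) :
  hsmash_pr X' y' (hsmash_map y y' f cg z) = f (hsmash_pr X y z).
Proof.
by have [x [t <-]] := prod_pi_surj z; rewrite prod_mod_mapE !hsmash_prE.
Qed.

(** [fs_dd] is [d_i d_j = d_(j-1) d_i] for [i < j], with [j] shifted by one. *)
Record facialSpace := FacialSpace {
  fs_sp :> nat -> cgSpace;
  fs_d : forall n, 'I_n.+2 -> cgMap (fs_sp n.+1) (fs_sp n);
  fs_dd : forall n (i j : 'I_n.+2), (i <= j)%N -> forall x : fs_sp n.+2,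
    fs_d i (fs_d (lift ord0 j) x) =
    fs_d j (fs_d (widen_ord (leqnSn _) i) x) }.

#[global] Arguments fs_d {f n} i.

Record facialResolution (X : cgSpace) := FacialResolution {
  fr_fs :> facialSpace;
  fr_aug : cgMap (fr_fs 0) X;
  fr_augd : forall x : fr_fs 1,
    fr_aug (fs_d ord0 x) = fr_aug (fs_d ord_max x) }.

Section Realization.
Variable F : facialSpace.

(** [X_m >< Delta^n]. *)
Definition hsimplex (m n : nat) : cgSpace := hsmash (F m) (vertex n).

(** [X_m >< delta^i] and [d_i >< Delta^n]. *)
Definition hcoface (m n : nat) (i : 'I_n.+2) :
    cgMap (hsimplex m n) (hsimplex m n.+1) :=
  hsmash_map (vertex n) (vertex n.+1) (pid (F m)) (@coface_continuous n i).

Definition hface (m n : nat) (i : 'I_m.+2) :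
    cgMap (hsimplex m.+1 n) (hsimplex m n) :=
  hsmash_map (vertex n) (vertex n) (fs_d i) (@id_cont (simplex n)).

Definition facets (n : nat) : Type := ('I_n.+2 * hsimplex n.+1 n)%type.

Definition facet_att (n : nat) (T : cgSpace) (chi : cgMap (hsimplex n n) T)
  (z : facets n) : T := chi (hface n z.1 z.2).

Definition facet_inc (n : nat) (z : facets n) : hsimplex n.+1 n.+1 :=
  hcoface n.+1 z.1 z.2.

Definition facet0 (n : nat) : facets n := (ord0, cg_pt (hsimplex n.+1 n)).

Lemma facet_att0 (n : nat) (T : cgSpace) (chi : cgMap (hsimplex n n) T) :
  facet_att chi (facet0 n) = cg_pt T.
Proof. by rewrite /facet_att !cgmap_pt. Qed.

Lemma facet_inc0 (n : nat) :
  facet_inc (facet0 n) = cg_pt (hsimplex n.+1 n.+1).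
Proof. by rewrite /facet_inc cgmap_pt. Qed.

(** [||F||_n] together with [chi_n].  Every point of [X_n >< bd Delta^n] is
    [(X_n >< delta^i) z] for some facet index [i] and
    [z : X_n >< Delta^(n-1)], and there [phi_n] takes the value
    [chi_(n-1) ((d_i >< Delta^(n-1)) z)]; the pushout along [phi_n] is thus the
    quotient of [||F||_(n-1) + X_n >< Delta^n] identifying these two points for
    all [(i, z)]. *)
Fixpoint realization_chi (n : nat) : {T : cgSpace & cgMap (hsimplex n n) T} :=
  match n with
  | 0 => existT (fun T => cgMap (hsimplex 0 0) T) (F 0)
           (hsmash_pr (F 0) (vertex 0))
  | n'.+1 =>
    let chi := projT2 (realization_chi n') in
    existT (fun T => cgMap (hsimplex n'.+1 n'.+1) T)
      (pushout (facet_att chi) (@facet_inc n'))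
      (pushout_in2 (facet_att0 chi) (facet_inc0 n'))
  end.

Definition realization (n : nat) : cgSpace := projT1 (realization_chi n).

Definition chi (n : nat) : cgMap (hsimplex n n) (realization n) :=
  projT2 (realization_chi n).

Definition realization_inc (n : nat) :
    cgMap (realization n) (realization n.+1) :=
  pushout_in1 (facet_att (chi n)) (@facet_inc n).

End Realization.

Section Canonical.
Variables (X : cgSpace) (F : facialResolution X).

(** [(d_0)^(n+1) : X_n -> X]. *)
Fixpoint aug_iter (n : nat) : cgMap (F n) X :=
  if n is n'.+1 then pcomp (aug_iter n') (fs_d ord0) else fr_aug F.

Lemma aug_iter_d (n : nat) (i : 'I_n.+2) (x : F n.+1) :
  aug_iter n (fs_d i x) = aug_iter n.+1 x.
Proof.
elim: n i x => [|n IH] i x.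
  rewrite /=; case: (unliftP ord0 i) => [j|] -> //.
  by rewrite fr_augd; congr (fr_aug F (fs_d _ x)); apply: val_inj; case: j => -[].
rewrite /=; case: (unliftP ord0 i) => [j|] -> //.
rewrite (@fs_dd _ _ ord0 j (leq0n _)) IH /=.
by congr (aug_iter n (fs_d _ (fs_d _ x))); apply: val_inj.
Qed.

Definition aug_pr (n : nat) : cgMap (hsimplex F n n) X :=
  pcomp (aug_iter n) (hsmash_pr (F n) (vertex n)).

Definition canonical_spec (n : nat) (c : cgMap (realization F n) X) : Prop :=
  forall z, c (chi F n z) = aug_pr n z.

Lemma canonical_compat (n : nat) (c : cgMap (realization F n) X) :
  canonical_spec c ->
  forall z, c (facet_att (chi F n) z) = aug_pr n.+1 (facet_inc z).
Proof.
move=> cc [i z]; rewrite /facet_att /facet_inc cc.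
rewrite -[LHS]/(aug_iter n (hsmash_pr _ _ _)) -[RHS]/(aug_iter n.+1 (hsmash_pr _ _ _)).
by rewrite !hsmash_map_pr aug_iter_d.
Qed.

Lemma canonical_spec0 : canonical_spec (n := 0) (fr_aug F).
Proof. by []. Qed.

Lemma canonical_specS (n : nat) (c : cgMap (realization F n) X)
    (cc : canonical_spec c) :
  canonical_spec (n := n.+1) (pushout_rec (canonical_compat cc)).
Proof. by move=> z; exact: (pushout_rec2 (canonical_compat cc)). Qed.

Fixpoint canonical_sig (n : nat) :
    {c : cgMap (realization F n) X | canonical_spec c} :=
  match n with
  | 0 => exist _ (fr_aug F : cgMap (realization F 0) X) canonical_spec0
  | n'.+1 =>
    exist _ (pushout_rec (canonical_compat (svalP (canonical_sig n')))
              : cgMap (realization F n'.+1) X)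
      (canonical_specS (svalP (canonical_sig n')))
  end.

Definition canonical_map (n : nat) : cgMap (realization F n) X :=
  sval (canonical_sig n).

Lemma canonical_chi (n : nat) (z : hsimplex F n n) :
  canonical_map n (chi F n z) = aug_iter n (hsmash_pr (F n) (vertex n) z).
Proof. exact: svalP (canonical_sig n) z. Qed.

Lemma canonical_inc (n : nat) (z : realization F n) :
  canonical_map n.+1 (realization_inc F n z) = canonical_map n z.
Proof. exact: pushout_rec1 (canonical_compat (svalP (canonical_sig n))) z. Qed.

End Canonical.

Section Lambda.
Variable X : cgSpace.

Definition Lambda_d (n : nat) (i : 'I_n.+2) :
    cgMap (so_iter X n.+2) (so_iter X n.+1) := so_face X n.+1 i.

Lemma Lambda_dd (n : nat) (i j : 'I_n.+2) : (i <= j)%N ->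
  forall x : so_iter X n.+3,
    Lambda_d i (Lambda_d (lift ord0 j) x) =
    Lambda_d j (Lambda_d (widen_ord (leqnSn _) i) x).
Proof.
move=> ij x; apply: (@so_faceK X n.+1 i j); rewrite ij /=; exact: (ltn_ord j).
Qed.

Definition Lambda_fs : facialSpace :=
  @FacialSpace (fun n => so_iter X n.+1) Lambda_d Lambda_dd.

Lemma Lambda_augd (x : Lambda_fs 1) :
  ev X (fs_d ord0 x) = ev X (fs_d ord_max x).
Proof. exact: esym (@so_faceK X 0 0 0 isT x). Qed.

Definition Lambda : facialResolution X :=
  @FacialResolution X Lambda_fs (ev X) Lambda_augd.

End Lambda.

Section Fibration.
Variables (A X : cgSpace) (f : cgMap A X).

Definition fib_set : set (A * paths X)%type :=
  [set p | path_at p.2 I0 = f p.1].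

Lemma fib_set_pt : fib_set (cg_pt A, cst_path (cg_pt X)).
Proof. by rewrite /fib_set /= cgmap_pt. Qed.

(** The associated fibration is [(a, w) |-> w 1] on the pairs with
    [w 0 = f a]. *)
Definition fib_space : cgSpace := ksub_space (X := kprod A (paths X)) fib_set_pt.

Definition fib_fun (e : fib_space) : X := path_at (ksub_val e).2 I1.

Lemma fib_fun_cont : continuous fib_fun.
Proof.
move=> e; apply: (@continuous_comp fib_space (kprod A (paths X)) X
  (@ksub_val _ _) (fun p => path_at p.2 I1)); first exact: ksub_val_continuous.
apply: (@kify_out_continuous (A * paths X)%type X) => p.
apply: (@continuous_comp (A * paths X)%type (paths X) X snd
  (fun w => path_at w I1)); first exact: cvg_snd.
exact: path_at_pt_continuous.
Qed.

Lemma fib_fun_pt : fib_fun (cg_pt fib_space) = cg_pt X.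
Proof. by []. Qed.

Definition fib_map : cgMap fib_space X := PMap fib_fun_cont fib_fun_pt.

End Fibration.

Definition cone_set (X : cgSpace) : set (X * unitI)%type :=
  [set p | p.1 = cg_pt X \/ p.2 = I0].

(** The reduced cone; its base is the copy of [X] at [I1]. *)
Definition cone (X : cgSpace) : cgSpace := prod_mod (@cone_set X) (cg_pt X, I0).

Definition cone_in (X : cgSpace) (x : X) : cone X := prod_pi _ _ x I1.

Lemma cone_in_pt (X : cgSpace) : cone_in (cg_pt X) = cg_pt (cone X).
Proof. by apply: glue_pi_eq; split; left. Qed.

Section Fiber.
Variables (G X : cgSpace) (p : cgMap G X).

Definition fiber_set : set G := [set e | p e = cg_pt X].

Definition fiber : cgSpace := ksub_space (cgmap_pt p : fiber_set (cg_pt G)).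

Definition fiber_in (e : fiber) : G := ksub_val e.

Lemma fiber_in_pt : fiber_in (cg_pt fiber) = cg_pt G.
Proof. by []. Qed.

Definition fiber_cofiber : cgSpace := pushout fiber_in (@cone_in fiber).

Lemma fiber_cofiber_compat (e : fiber) :
  p (fiber_in e) = pcst (cone fiber) X (cone_in e).
Proof. exact: ksub_valP e. Qed.

Definition fiber_cofiber_map : cgMap fiber_cofiber X :=
  pushout_rec fiber_cofiber_compat.

End Fiber.

Section Ganea.
Variable X : cgSpace.

(** [ganea_from1 n] is [p_(n+1) : G_(n+1)(X) -> X].  As [p_n] is the path
    fibration associated to a map [p'], its strict fibre [fiber p_n] is the
    standard homotopy fibre [{(a, w) | w 0 = p' a, w 1 = *}] of [p'], and
    [p_n] is constant on it, so that it extends to the cone. *)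
Fixpoint ganea_from1 (n : nat) : {G : cgSpace & cgMap G X} :=
  if n is n'.+1 then
    let p' := fiber_cofiber_map (projT2 (ganea_from1 n')) in
    existT (fun G => cgMap G X) (fib_space p') (fib_map p')
  else existT (fun G => cgMap G X) (fib_space (ev X)) (fib_map (ev X)).

(** [G_n(X)] and [p_n] for [n >= 1]; the value at [n = 0] is irrelevant. *)
Definition ganea (n : nat) : cgSpace := projT1 (ganea_from1 n.-1).

Definition ganea_map (n : nat) : cgMap (ganea n) X := projT2 (ganea_from1 n.-1).

End Ganea.

(** The inclusion of the base point has the homotopy extension property. *)
Definition well_pointed (X : cgSpace) : Prop :=
  forall (Y : topologicalType) (f : X -> Y) (h : unitI -> Y),
    compactly_generated Y -> continuous f -> continuous h ->
    h I0 = f (cg_pt X) ->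
  exists H : X -> unitI -> Y,
    [/\ continuous (kuncurry H), (forall x, H x I0 = f x) &
        forall s, H (cg_pt X) s = h s].

Definition homotopic (X Y : topologicalType) (f g : X -> Y) : Prop :=
  exists H : X -> unitI -> Y,
    [/\ continuous (kuncurry H), (forall x, H x I0 = f x) &
        forall x, H x I1 = g x].

Definition homotopy_equivalent (X Y : topologicalType) : Prop :=
  exists (f : X -> Y) (g : Y -> X),
    [/\ continuous f, continuous g, homotopic (g \o f) id &
        homotopic (f \o g) id].

Definition sqnorm (n : nat) (u : 'rV[R]_n) : R := \sum_j u ord0 j ^+ 2.
Definition disk (n : nat) : set 'rV[R]_n := [set u | sqnorm u <= 1].
Definition open_disk (n : nat) : set 'rV[R]_n := [set u | sqnorm u < 1].
Definition sphere (n : nat) : set 'rV[R]_n := [set u | sqnorm u = 1].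

(** Characteristic maps [Phi i] of the cells, of dimension [d i]: the open cells
    partition [T], boundaries lie in finitely many cells of lower dimension, and
    [T] has the weak topology with respect to the closed cells. *)
Definition is_CW_complex (T : topologicalType) : Prop :=
  hausdorff_space T /\
  exists (I : Type) (d : I -> nat) (Phi : forall i, 'rV[R]_(d i) -> T),
  [/\ forall i, {within @disk (d i), continuous (Phi i)},
      forall t, exists i u, @open_disk (d i) u /\ Phi i u = t,
      forall i j u v, @open_disk (d i) u -> @open_disk (d j) v ->
        Phi i u = Phi j v ->
        existT (fun k => 'rV[R]_(d k)) i u = existT _ j v,
      forall i, exists J : set I, [/\ finite_set J,
        (forall j, J j -> (d j < d i)%N) &
        Phi i @` @sphere (d i) `<=` \bigcup_(j in J) Phi j @` @open_disk (d j)] &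
      forall A : set T,
        (forall i, closed (A `&` Phi i @` @disk (d i))) -> closed A].

(** Objects of the category of well-pointed compactly generated spaces having
    the homotopy type of a CW-complex. *)
Definition in_Top (X : cgSpace) : Prop :=
  well_pointed X /\
  exists T : topologicalType, is_CW_complex T /\ homotopy_equivalent X T.

End Constructions.

(* Main.v *)
From mathcomp Require Import all_boot all_order all_algebra generic_quotient.
From mathcomp Require Import all_classical all_reals all_analysis.
From mathcomp Require Import ring lra zify.
Require Import Defs.

Import numFieldNormedType.Exports.
Import Order.TTheory GRing.Theory Num.Theory.

Set Implicit Arguments.
Unset Strict Implicit.
Unset Printing Implicit Defensive.

Local Open Scope classical_set_scope.
Local Open Scope ring_scope.
Local Open Scope quotient_scope.

(** The canonical maps [c_n : ||Lambda X||_n -> X] are lifted by induction on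
    [n].  The lift of [c_0 = ev] sends [a] to [a] with the constant path at
    [ev a].

    For the step, let [p : G -> X] be a Ganea fibration, [c_n = p s], and let
    [G'] be the next Ganea space, into which [G] maps over [X] by [ganea_incl].
    The realization grows by [S >< Delta^(n+1)], where [S = Lambda_(n+1) X] is a
    suspension [Sigma B], and on each facet [S >< delta^i] the lift is already
    known: it is [ganea_incl (h_i (x, t))], where [h_i] is [s] composed with the
    attaching map.  All of this lies over [g = aug_iter (n+1) : S -> X], which
    does not depend on [t].  A filling of [S >< Delta^(n+1)] in [G'] over [g] is
    needed, and only the suspension structure of [S] is used to find it.

    Fix [b] in [B].  The ray [u |-> g [b, u]] starts at the base point of [X].
    Hence a point [e] of [G] over [g [b, s']] can be carried back along the ray
    to the fibre of [p] over the base point ([slide]), where the cone attached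
    in [G'] contracts it; remembering the piece of the ray that leads to
    [g [b, s]] keeps the whole motion in the fibre of [G'] over [g [b, s]].
    This is [contract e s r], with [r] the time: it is [e] itself at time [0] if
    [s' = s], and at time [1] it depends on [b] and [s] only.

    At [s = 1] the ray has become a loop that need not be trivial, so that
    contracting [Delta^(n+1)] for each [s] separately would not give the base
    point there.  The remedy is to cone off the boundary of the whole prism
    [Delta^(n+1) * [0, 1]]: the map is given by the [h_i] on the walls
    [bd Delta^(n+1) * [0, 1]] and is constant at both ends, and an inner point
    is moved radially to a boundary point over some [s'] before [contract] is
    applied.  The height [s'] is [stretch d s] and the time is [radius d s],
    where [d] is the depth of the point in the simplex; where [d = 1] the point
    lands on an end or the time is [1], so that the choice of a facet does not
    matter ([prism_deep], [fill_at_indep]).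

    Continuity is proved by gluing over finite closed covers
    ([closed_cover_continuous]); the passage from [B * I * Delta] to
    [S * Delta] uses that the product of a quotient map with a compact Hausdorff
    space is a quotient map ([glue_kprod_continuous]). *)

(** * Continuity and compactly generated spaces *)

Lemma comp_continuous (S T U : topologicalType) (f : S -> T) (g : T -> U) :
  continuous g -> continuous f -> continuous (fun x => g (f x)).
Proof. by move=> cg cf x; apply: continuous_comp; [exact: cf|exact: cg]. Qed.

Lemma cg_continuous (T Z : topologicalType) (f : T -> Z) :
  compactly_generated T ->
  (forall (K : topologicalType) (g : K -> T), compact [set: K] ->
    hausdorff_space K -> continuous g -> continuous (f \o g)) ->
  continuous f.
Proof.
move=> cT fK; apply/continuousP => U oU; apply: cT => K g cK hK cg.
by move/continuousP: (fK K g cK hK cg) => /(_ U oU).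
Qed.

Lemma pair_continuous (L X Y : topologicalType) (f : L -> X) (g : L -> Y) :
  continuous f -> continuous g -> continuous (fun l => (f l, g l)).
Proof. by move=> cf cg l; apply: cvg_pair; [exact: cf|exact: cg]. Qed.

Lemma kpair_continuous (L X Y : topologicalType) (f : L -> X) (g : L -> Y) :
  compactly_generated L -> continuous f -> continuous g ->
  continuous ((fun l => (f l, g l)) : L -> kprod X Y).
Proof.
by move=> cL cf cg; apply: to_kify_continuous => //; exact: pair_continuous.
Qed.

Lemma kfst_continuous (X Y : topologicalType) :
  continuous (fst : kprod X Y -> X).
Proof. by apply: kify_out_continuous => p; exact: cvg_fst. Qed.

Lemma ksnd_continuous (X Y : topologicalType) :
  continuous (snd : kprod X Y -> Y).
Proof. by apply: kify_out_continuous => p; exact: cvg_snd. Qed.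

Lemma prod_compact (K L : topologicalType) :
  compact [set: K] -> compact [set: L] -> compact [set: (K * L)%type].
Proof. by move=> cK cL; rewrite -setXTT; exact: compact_setX. Qed.

Lemma prod_hausdorff (K L : topologicalType) :
  hausdorff_space K -> hausdorff_space L -> hausdorff_space (K * L)%type.
Proof.
move=> hK hL [a b] [a' b'] clab; congr pair.
- apply: hK => U V nU nV; have [] := clab (fst @^-1` U) (fst @^-1` V).
  + exact: (@cvg_fst _ _ (nbhs a) (nbhs b)).
  + exact: (@cvg_fst _ _ (nbhs a') (nbhs b')).
  + by move=> [x y] [/= Ux Vx]; exists x.
- apply: hL => U V nU nV; have [] := clab (snd @^-1` U) (snd @^-1` V).
  + exact: (@cvg_snd _ _ (nbhs a) (nbhs b)).
  + exact: (@cvg_snd _ _ (nbhs a') (nbhs b')).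
  + by move=> [x y] [/= Ux Vx]; exists y.
Qed.

(** Between compact Hausdorff spaces the ordinary product is already compactly
    generated. *)
Lemma kprod_prod_continuous (K L Z : topologicalType) (f : kprod K L -> Z) :
  compact [set: K] -> hausdorff_space K ->
  compact [set: L] -> hausdorff_space L ->
  continuous f -> continuous (f : (K * L)%type -> Z).
Proof.
move=> cK hK cL hL cf.
have cid : continuous (id : (K * L)%type -> kprod K L).
  apply: to_kify_continuous; last by move=> x U.
  by apply: compact_hausdorff_cg; [exact: prod_compact|exact: prod_hausdorff].
exact: (@comp_continuous _ (kprod K L) _ _ f cf cid).
Qed.

Lemma kcurry_continuous (T K Z : topologicalType) (h : T -> K -> Z) :
  compactly_generated T -> compact [set: K] -> hausdorff_space K ->
  continuous (kuncurry h) -> continuous (h : T -> {compact-open, K -> Z}).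
Proof.
move=> cT cK hK ch; apply: cg_continuous => // L g cL hL cg.
pose h' (p : L * K) := h (g p.1) p.2.
have ch' : continuous h'.
  apply: (@kprod_prod_continuous L K Z h') => //.
  exact: (@comp_continuous (kprod L K) (kprod T K) Z _ _ ch
    (kprod_map_continuous cg (@id_cont K))).
by have := continuous_curry_fun ch'.
Qed.

(** A quotient map times a compact Hausdorff space is again a quotient map:
    currying turns the second factor into a mapping space, on which maps out of
    the quotient are detected. *)
Lemma glue_kprod_continuous (T K Z : topologicalType) (r : T -> T -> Prop)
    (h : glue r -> K -> Z) :
  compactly_generated T -> compact [set: K] -> hausdorff_space K ->
  continuous (kuncurry (fun x => h (glue_pi r x))) -> continuous (kuncurry h).
Proof.
move=> cT cK hK ch.
have c1 : continuous (h \o glue_pi r : T -> {compact-open, K -> Z}).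
  exact: (@kcurry_continuous T K Z (fun x => h (glue_pi r x))).
have c2 : continuous (h : glue r -> {compact-open, K -> Z}).
  exact/(@quotient_continuous T {eq_quot glue_equiv r}).
apply: (@kify_out_continuous (glue r * K)%type Z).
rewrite (_ : kuncurry h = uncurry h); last by apply/funext => -[].
apply: continuous_uncurry => //.
- move=> x _; exists [set: K]; first by rewrite withinET; exact: filterT.
  by split; [exact: cK|exact: closedT].
- move=> q; have [x <-] := glue_pi_surj q.
  have cx : continuous ((fun k => (x, k)) : K -> kprod T K).
    apply: kpair_continuous; [exact: compact_hausdorff_cg|exact: cst_continuous|].
    exact: id_cont.
  exact: (@comp_continuous K (kprod T K) Z _ _ ch cx).
Qed.

(** Tested on a compact Hausdorff space, the preimage of a closed set is a finite
    union of continuous images of compact sets, hence closed. *)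
Lemma closed_cover_continuous (I : finType) (T Z : topologicalType)
    (A : I -> set T) (f : T -> Z) :
  compactly_generated T -> (forall i, closed (A i)) ->
  (forall x, exists i, A i x) ->
  (forall i, continuous (fun x : ksub (A i) => f (ksub_val x))) -> continuous f.
Proof.
move=> cT clA covA cf; apply: cg_continuous => // K g cK hK cg.
apply/continuous_closedP => C clC.
have -> : (f \o g) @^-1` C =
    \big[setU/set0]_(i <- enum I) (set_val @` [set x : set_type (g @^-1` A i) |
       C (f (g (set_val x)))]).
  rewrite -bigcup_seq; apply/seteqP; split=> [x Cx|x [i _ [y Cy <-]] //].
  have [i Ai] := covA (g x); exists i; first by rewrite /= mem_enum.
  by exists (SigSub (mem_set (Ai : (g @^-1` A i) x))).
apply: closed_bigsetU => i _.
apply: compact_closed => //.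
have cAi : compact (g @^-1` A i).
  apply: (@subclosed_compact _ _ [set: K]) => //.
  by move/continuous_closedP: cg; apply; exact: clA.
have cS := set_type_compact cAi.
have hS := @set_type_hausdorff K (g @^-1` A i) hK.
apply: continuous_compact.
  by apply: continuous_subspaceT; exact: initial_continuous.
apply: (@subclosed_compact _ _ [set: set_type (g @^-1` A i)]) => //.
apply: (proj1 (continuous_closedP
  (fun x : set_type (g @^-1` A i) => f (g (set_val x)))) _ _ clC).
have Ag (x : set_type (g @^-1` A i)) : A i (g (set_val x)) by exact: set_valP x.
apply: (@comp_continuous _ _ _ (fun x => ksub_in (Ag x)) _ (cf i)).
apply: ksub_in_continuous; first exact: compact_hausdorff_cg.
apply: comp_continuous cg _; exact: initial_continuous.
Qed.

Lemma prod_pi_comp (L X Y : topologicalType) (A : set (X * Y)%type)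
    (a : (X * Y)%type) (x : L -> X) (y : L -> Y) :
  compactly_generated L -> continuous x -> continuous y ->
  continuous (fun l => prod_pi A a (x l) (y l)).
Proof.
move=> cL cx cy.
exact: (@comp_continuous L (kprod X Y) _ _ _ (@prod_pi_continuous X Y A a)
  (kpair_continuous cL cx cy)).
Qed.

(** * The unit interval and path spaces *)

Section RealValued.
Variables (R : realType) (L : topologicalType).
Implicit Types f g : L -> R.

Lemma realD_continuous f g :
  continuous f -> continuous g -> continuous (fun l => f l + g l).
Proof. by move=> cf cg l; exact: (@continuousD R R^o L f g l (cf l) (cg l)). Qed.

Lemma realB_continuous f g :
  continuous f -> continuous g -> continuous (fun l => f l - g l).
Proof. by move=> cf cg l; exact: (@continuousB R R^o L f g l (cf l) (cg l)). Qed.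

Lemma realM_continuous f g :
  continuous f -> continuous g -> continuous (fun l => f l * g l).
Proof. by move=> cf cg l; exact: (continuousM (cf l) (cg l)). Qed.

Lemma realmin_continuous f g :
  continuous f -> continuous g -> continuous (fun l => Num.min (f l) (g l)).
Proof. by move=> cf cg l; exact: (continuous_min (cf l) (cg l)). Qed.

End RealValued.

Section Paths.
Variable R : realType.
Local Notation I := (unitI R).
Local Notation I0 := (I0 R).
Local Notation I1 := (I1 R).

Definition ival (s : I) : R := set_val s.

Lemma ival_continuous : continuous ival.
Proof. exact: initial_continuous. Qed.

Lemma ival_inj : injective ival.
Proof. exact: val_inj. Qed.

Lemma ivalP (s : I) : 0 <= ival s <= 1.
Proof. by have := set_valP s; rewrite /= in_itv. Qed.

Lemma clamp_subproof (x : R) : `[0, 1]%classic (Num.min (Num.max x 0) 1).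
Proof. by rewrite /= in_itv /= le_min ge_min ler01 !le_max !lexx !orbT. Qed.

(** Clamping makes every formula for a parameter a total continuous map, so that
    both branches of a case distinction extend to the whole space. *)
Definition clamp (x : R) : I := SigSub (mem_set (clamp_subproof x)).

Lemma ival_clamp (x : R) : ival (clamp x) = Num.min (Num.max x 0) 1.
Proof. by []. Qed.

Lemma ival0 : ival I0 = 0. Proof. by []. Qed.
Lemma ival1 : ival I1 = 1. Proof. by []. Qed.

Lemma clampK (x : R) : 0 <= x <= 1 -> ival (clamp x) = x.
Proof. by move=> /andP[x0 x1]; rewrite ival_clamp (max_idPl x0) (min_idPl x1). Qed.

Lemma clamp_ival (s : I) : clamp (ival s) = s.
Proof. by apply: ival_inj; rewrite clampK ?ivalP. Qed.

Lemma clamp_le0 (x : R) : x <= 0 -> clamp x = I0.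
Proof.
move=> x0; apply: ival_inj.
by rewrite ival_clamp (max_idPr x0) ?ival0 (min_idPl ler01).
Qed.

Lemma clamp_ge1 (x : R) : 1 <= x -> clamp x = I1.
Proof.
move=> x1; apply: ival_inj; rewrite ival_clamp ival1.
by rewrite (max_idPl (le_trans ler01 x1)) (min_idPr x1).
Qed.

Lemma clamp_continuous : continuous clamp.
Proof.
apply: continuous_comp_initial => x.
have c0 := @cst_continuous R R 0; have c1 := @cst_continuous R R 1.
exact: (continuous_min (continuous_max (@id_cont R x) (c0 x)) (c1 x)).
Qed.

Lemma mkpath_continuous (L X : topologicalType) (f : L -> I -> X)
    (cf : forall l, continuous (f l)) :
  compactly_generated L -> continuous (kuncurry f) ->
  continuous (fun l => mkpath (cf l)).
Proof.
move=> cL cuf; apply: to_kify_continuous => //.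
apply: continuous_comp_initial.
exact: (kcurry_continuous cL (@unitI_compact R) (@unitI_hausdorff R) cuf).
Qed.

Lemma path_eq (X : topologicalType) (w w' : paths R X) :
  (forall s, path_at w s = path_at w' s) -> w = w'.
Proof. by move=> h; apply/continuousEP. Qed.

Lemma path_at_comp (L X : topologicalType) (w : L -> paths R X) (s : L -> I) :
  compactly_generated L -> continuous w -> continuous s ->
  continuous (fun l => path_at (w l) (s l)).
Proof.
move=> cL cw cs.
exact: (@comp_continuous L (kprod (paths R X) I) X _ _
  (@path_at_kcontinuous R X) (kpair_continuous cL cw cs)).
Qed.

Lemma ival_comp (L : topologicalType) (s : L -> I) :
  continuous s -> continuous (fun l => ival (s l)).
Proof. exact: comp_continuous ival_continuous. Qed.

Lemma clamp_comp (L : topologicalType) (x : L -> R) :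
  continuous x -> continuous (fun l => clamp (x l)).
Proof. exact: comp_continuous clamp_continuous. Qed.

End Paths.

(** * Sliding along a path in an associated fibration *)

(** Asking for branches that are continuous everywhere keeps restrictions to
    closed pieces out of the applications. *)
Lemma if_le_continuous (R : realType) (L Z : topologicalType) (x : L -> R)
    (c : R) (f g : L -> Z) :
  compactly_generated L -> continuous x -> continuous f -> continuous g ->
  (forall l, x l = c -> f l = g l) ->
  continuous (fun l => if x l <= c then f l else g l).
Proof.
move=> cL cx cf cg fg.
pose A (b : bool) : set L := [set l | if b then x l <= c else c <= x l].
have clA b : closed (A b).
  case: b.
  - exact: (proj1 (continuous_closedP x) cx _ (@closed_le R c)).
  - exact: (proj1 (continuous_closedP x) cx _ (@closed_ge R c)).
apply: (closed_cover_continuous (A := A)) => // [l|b].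
  by case: (leP (x l) c) => h; [exists true|exists false; exact: ltW].
have cv := @ksub_val_continuous L (A b).
case: b cv => cv.
- rewrite (_ : (fun _ => _) = fun l : ksub (A true) => f (ksub_val l)).
    exact: comp_continuous cf cv.
  by apply/funext => l; have /= -> := ksub_valP l.
- rewrite (_ : (fun _ => _) = fun l : ksub (A false) => g (ksub_val l)).
    exact: comp_continuous cg cv.
  apply/funext => l; have /= h := ksub_valP l.
  by case: leP => // h'; apply: fg; apply/le_anti; rewrite h h'.
Qed.

Section Fib.
Variables (R : realType) (A X : cgSpace) (q : cgMap A X).
Local Notation I := (unitI R).
Local Notation I0 := (I0 R).
Local Notation I1 := (I1 R).
Local Notation G := (fib_space R q).
Local Notation p := (fib_map R q).

Definition mkfib (a : A) (w : paths R X) (h : path_at w I0 = q a) : G :=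
  ksub_in (X := kprod A (paths R X)) (A := fib_set q) (x := (a, w)) h.

Definition fib_pt (e : G) : A := (ksub_val e).1.
Definition fib_path (e : G) : paths R X := (ksub_val e).2.

Lemma fib_path0 (e : G) : path_at (fib_path e) I0 = q (fib_pt e).
Proof. exact: (ksub_valP e). Qed.

Lemma fib_pt_continuous : continuous fib_pt.
Proof.
exact: comp_continuous (@kfst_continuous _ _) (@ksub_val_continuous _ _).
Qed.

Lemma fib_path_continuous : continuous fib_path.
Proof.
exact: comp_continuous (@ksnd_continuous _ _) (@ksub_val_continuous _ _).
Qed.

Lemma fib_eq (e e' : G) :
  fib_pt e = fib_pt e' -> fib_path e = fib_path e' -> e = e'.
Proof.
rewrite /fib_pt /fib_path => h1 h2; apply: ksub_val_inj.
by rewrite [LHS]surjective_pairing h1 h2 -surjective_pairing.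
Qed.

Lemma mkfib_continuous (L : topologicalType) (a : L -> A) (w : L -> paths R X)
    (h : forall l, path_at (w l) I0 = q (a l)) :
  compactly_generated L -> continuous a -> continuous w ->
  continuous (fun l => mkfib (h l)).
Proof.
move=> cL ca cw.
exact: (@ksub_in_continuous (kprod A (paths R X)) (fib_set q) L
  (fun l => (a l, w l)) h cL
  (kpair_continuous cL ca cw)).
Qed.

(** The path of [e], followed by [g] run backwards from [s] to [(1 - rho) s], as
    a path of total length [1 + rho] rescaled to [[0, 1]].  With this
    parametrization [slide] is strictly the identity for [rho = 0]. *)
Definition slide_fun (e : G) (g : paths R X) (s rho v : I) : X :=
  let x := (1 + ival rho) * ival v in
  if x <= 1 then path_at (fib_path e) (clamp x)
  else path_at g (clamp ((2 - x) * ival s)).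

Lemma slide_fun_continuous (L : topologicalType) (e : L -> G)
    (g : L -> paths R X) (s rho : L -> I) :
  compactly_generated L -> continuous e -> continuous g -> continuous s ->
  continuous rho -> (forall l, p (e l) = path_at (g l) (s l)) ->
  continuous (kuncurry (fun l => slide_fun (e l) (g l) (s l) (rho l))).
Proof.
move=> cL ce cg cs cr h; have cLI := @kify_cg (L * I)%type.
have c1 := @kfst_continuous L I; have c2 := @ksnd_continuous L I.
have cx : continuous (fun l : kprod L I => (1 + ival (rho l.1)) * ival l.2).
  apply: realM_continuous; last exact: ival_comp.
  apply: realD_continuous; first exact: cst_continuous.
  apply: ival_comp; exact: comp_continuous cr c1.
apply: (if_le_continuous (x := fun l : kprod L I => (1 + ival (rho l.1)) * ival l.2)
  (f := fun l : kprod L I =>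
     path_at (fib_path (e l.1)) (clamp ((1 + ival (rho l.1)) * ival l.2)))
  (g := fun l : kprod L I => path_at (g l.1)
    (clamp ((2 - ((1 + ival (rho l.1)) * ival l.2)) * ival (s l.1))))) => //.
- apply: path_at_comp => //.
    exact: (comp_continuous fib_path_continuous (comp_continuous ce c1)).
  exact: clamp_comp.
- apply: path_at_comp => //; first exact: comp_continuous cg c1.
  apply: clamp_comp; apply: realM_continuous.
    apply: realB_continuous => //; exact: cst_continuous.
  apply: ival_comp; exact: comp_continuous cs c1.
- move=> [l v] /= ->; rewrite clamp_ge1 // (_ : 2 - 1 = 1 :> R); last by lra.
  by rewrite mul1r clamp_ival -h.
Qed.

Section Slide.
Variables (e : G) (g : paths R X) (s : I) (h : p e = path_at g s).

Lemma slide_cont (rho : I) : continuous (slide_fun e g s rho).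
Proof.
have cI := compact_hausdorff_cg (@unitI_compact R) (@unitI_hausdorff R).
have cst (Y : topologicalType) (y : Y) : continuous ((fun=> y) : I -> Y).
  exact: cst_continuous.
have cu := @slide_fun_continuous I (fun=> e) (fun=> g) (fun=> s) (fun=> rho)
  cI (cst _ _) (cst _ _) (cst _ _) (cst _ _) (fun=> h).
exact: (@comp_continuous I (kprod I I) X _ _ cu
  (kpair_continuous cI (cst _ I0) (@id_cont I))).
Qed.

Lemma slide_proof (rho : I) :
  path_at (mkpath (@slide_cont rho)) I0 = q (fib_pt e).
Proof.
rewrite -fib_path0 -[LHS]/(slide_fun e g s rho I0) /slide_fun ival0 mulr0 ler01.
by rewrite clamp_le0.
Qed.

Definition slide (rho : I) : G := mkfib (slide_proof rho).

Lemma slide0 : slide I0 = e.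
Proof.
apply: fib_eq => //; apply: path_eq => v.
rewrite -[LHS]/(slide_fun e g s I0 v) /slide_fun ival0 addr0 mul1r.
by have /andP[_ ->] := ivalP v; rewrite clamp_ival.
Qed.

Lemma slide_map (rho : I) :
  p (slide rho) = path_at g (clamp ((1 - ival rho) * ival s)).
Proof.
rewrite -[LHS]/(slide_fun e g s rho I1) /slide_fun ival1 mulr1.
have /andP[r0 _] := ivalP rho; case: leP => r1.
  have -> : ival rho = 0 by lra.
  by rewrite subr0 addr0 mul1r clamp_ival -h clamp_ge1.
by congr (path_at g (clamp (_ * _))); ring.
Qed.

End Slide.

Lemma slide_continuous (L : topologicalType) (e : L -> G) (g : L -> paths R X)
    (s rho : L -> I) (h : forall l, p (e l) = path_at (g l) (s l)) :
  compactly_generated L -> continuous e -> continuous g -> continuous s ->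
  continuous rho -> continuous (fun l => slide (h l) (rho l)).
Proof.
move=> cL ce cg cs cr; apply: mkfib_continuous => //.
  exact: comp_continuous fib_pt_continuous ce.
apply: mkpath_continuous => //; exact: slide_fun_continuous.
Qed.

Lemma slide_pt (s rho : I) (h : p (cg_pt G) = path_at (cst_path R (cg_pt X)) s) :
  slide h rho = cg_pt G.
Proof.
apply: fib_eq => //; apply: path_eq => v.
by rewrite -[LHS]/(slide_fun _ _ _ _ v) /slide_fun; case: ifP.
Qed.

End Fib.

(** * Contracting into the next Ganea space *)

Section Contraction.
Variables (R : realType) (A X : cgSpace) (q : cgMap A X).
Local Notation I := (unitI R).
Local Notation I0 := (I0 R).
Local Notation I1 := (I1 R).
Local Notation G := (fib_space R q).
Local Notation p := (fib_map R q).
Local Notation F := (fiber p).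
Local Notation C := (fiber_cofiber R p).
Local Notation p' := (fiber_cofiber_map R p).
Local Notation G' := (fib_space R p').

Definition cof_in : cgMap G C := pushout_in1 (@fiber_in G X p) (@cone_in R F).
Definition cof_cone (z : cone R F) : C := po2 (@fiber_in G X p) (@cone_in R F) z.

Lemma cof_cone_continuous : continuous cof_cone.
Proof. exact: po2_continuous. Qed.

Lemma cof_inE (x : F) : cof_in (fiber_in x) = cof_cone (cone_in R x).
Proof. exact: po_glue. Qed.

Lemma cof_cone_pt : cof_cone (cg_pt (cone R F)) = cg_pt C.
Proof. by rewrite -cone_in_pt -cof_inE. Qed.

Lemma cof_map_in (e : G) : p' (cof_in e) = p e.
Proof. exact: (pushout_rec1 (fiber_cofiber_compat R (p := p))). Qed.

Lemma cof_map_cone (z : cone R F) : p' (cof_cone z) = cg_pt X.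
Proof. exact: (pushout_rec2 (fiber_cofiber_compat R (p := p))). Qed.

Lemma ganea_incl_proof (e : G) :
  path_at (cst_path R (p e)) I0 = p' (cof_in e).
Proof. by rewrite cof_map_in. Qed.

Definition ganea_incl_fun (e : G) : G' := mkfib (ganea_incl_proof e).

Lemma ganea_incl_cont : continuous ganea_incl_fun.
Proof.
have cG := @cg_gen G.
apply: mkfib_continuous => //; first exact: cgmap_cont.
apply: mkpath_continuous => //.
exact: comp_continuous (@cgmap_cont _ _ p) (@kfst_continuous _ _).
Qed.

Lemma ganea_incl_pt : ganea_incl_fun (cg_pt G) = cg_pt G'.
Proof. exact: fib_eq. Qed.

Definition ganea_incl : cgMap G G' := PMap ganea_incl_cont ganea_incl_pt.

Section Contract.
Variables (e : G) (g : paths R X) (s : I).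
Hypotheses (h : p e = path_at g s) (g0 : path_at g I0 = cg_pt X).

Lemma slide1_fiber : fiber_set p (slide h I1).
Proof.
by apply: (etrans (slide_map h I1)); rewrite ival1 subrr mul0r clamp_le0.
Qed.

Definition slide_fiber : F := ksub_in slide1_fiber.

(** During the first half of the time the point slides to the fibre over the base
    point, during the second half it moves up the cone over that fibre. *)
Definition contract_pt (r : I) : C :=
  if ival r <= 2^-1 then cof_in (slide h (clamp (2 * ival r)))
  else cof_cone (prod_pi (@cone_set R F) (cg_pt F, I0) slide_fiber
                   (clamp (2 - 2 * ival r))).

(** The part of [g] from the current position of the sliding point to [t]; it
    keeps [contract] in the fibre over [g t]. *)
Definition contract_fun (t r v : I) : X :=
  path_at g (clamp ((1 - ival v) * ((1 - ival (clamp (2 * ival r))) * ival s)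
                    + ival v * ival t)).

Lemma contract_cont (t r : I) : continuous (contract_fun t r).
Proof.
have ci := @ival_continuous R.
apply: comp_continuous; first exact: path_cont.
apply: clamp_comp; apply: realD_continuous; apply: realM_continuous => //.
by apply: realB_continuous => //; exact: cst_continuous.
- exact: cst_continuous.
- exact: cst_continuous.
Qed.

Lemma contract_proof (t r : I) :
  path_at (mkpath (@contract_cont t r)) I0 = p' (contract_pt r).
Proof.
rewrite -[LHS]/(contract_fun t r I0) /contract_fun ival0 subr0 mul1r mul0r addr0.
rewrite /contract_pt; case: leP => hr; first by rewrite cof_map_in slide_map.
have /andP[_ r1] := ivalP r.
by rewrite cof_map_cone (clamp_ge1 (x := 2 * ival r)) ?ival1 ?subrr ?mul0r ?clamp_le0 //; lra.
Qed.

Definition contract (t r : I) : G' := mkfib (contract_proof t r).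

Lemma contract_map (t r : I) : fib_map R p' (contract t r) = path_at g t.
Proof.
rewrite -[LHS]/(contract_fun t r I1) /contract_fun ival1 subrr mul0r mul1r add0r.
by rewrite clamp_ival.
Qed.

Lemma contract0 : contract s I0 = ganea_incl e.
Proof.
have cl0 : clamp (2 * ival I0) = I0 by rewrite ival0 mulr0 clamp_le0.
apply: fib_eq.
  rewrite -[LHS]/(contract_pt I0) /contract_pt cl0 slide0 ival0.
  by rewrite invr_ge0 ler0n.
apply: path_eq => v; rewrite -[LHS]/(contract_fun s I0 v) -[RHS]/(p e) h.
rewrite /contract_fun cl0 ival0 subr0 mul1r -mulrDl subrK mul1r.
by rewrite clamp_ival.
Qed.

End Contract.

(** At time [1] the point is the vertex of the cone and the remembered path is
    [g] from [0] to [t], so that [e] and its height [s] are forgotten. *)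
Lemma contract1 (e e' : G) (g : paths R X) (s s' : I)
    (h : p e = path_at g s) (h' : p e' = path_at g s')
    (g0 : path_at g I0 = cg_pt X) (t : I) :
  contract h g0 t I1 = contract h' g0 t I1.
Proof.
have cl1 : clamp (2 * ival I1) = I1 by rewrite ival1 mulr1 clamp_ge1 // ler1n.
apply: fib_eq.
  have E (e0 : G) (s0 : I) (h0 : p e0 = path_at g s0) :
      contract_pt h0 g0 I1 = cg_pt C.
    rewrite /contract_pt ival1 ifF; last by apply/negbTE; rewrite -ltNge; lra.
    rewrite -cof_cone_pt; congr cof_cone; apply: glue_pi_eq.
    by split; right => //=; rewrite mulr1 subrr clamp_le0.
  by rewrite -[LHS]/(contract_pt h g0 I1) -[RHS]/(contract_pt h' g0 I1) !E.
apply: path_eq => v.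
rewrite -[LHS]/(contract_fun g s t I1 v) -[RHS]/(contract_fun g s' t I1 v).
by rewrite /contract_fun cl1 ival1 subrr !mul0r.
Qed.

Lemma contract_base (e : G) (g : paths R X) (s t r : I)
    (h : p e = path_at g s) (g0 : path_at g I0 = cg_pt X) :
  e = cg_pt G -> g = cst_path R (cg_pt X) -> contract h g0 t r = cg_pt G'.
Proof.
move=> Ee Eg; subst e g.
apply: fib_eq; last exact: path_eq.
rewrite -[LHS]/(contract_pt h g0 r) /contract_pt; case: ifP => _.
  by rewrite slide_pt cgmap_pt.
rewrite -[RHS]cof_cone_pt; congr cof_cone; apply: glue_pi_eq; split; left => //.
by apply: ksub_val_inj; exact: slide_pt.
Qed.

Lemma contract_continuous (L : topologicalType) (e : L -> G)
    (g : L -> paths R X) (s t r : L -> I)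
    (h : forall l, p (e l) = path_at (g l) (s l))
    (g0 : forall l, path_at (g l) I0 = cg_pt X) :
  compactly_generated L -> continuous e -> continuous g -> continuous s ->
  continuous t -> continuous r ->
  continuous (fun l => contract (h l) (g0 l) (t l) (r l)).
Proof.
move=> cL ce cg cs ct cr.
have cst (T : topologicalType) (x : R) : continuous ((fun=> x) : T -> R).
  exact: cst_continuous.
apply: mkfib_continuous => //.
- apply: if_le_continuous => //; first exact: ival_comp.
  + apply: comp_continuous; first exact: cgmap_cont.
    apply: slide_continuous => //; apply: clamp_comp.
    by apply: realM_continuous => //; exact: ival_comp.
  + apply: comp_continuous; first exact: cof_cone_continuous.
    apply: prod_pi_comp => //.
      apply: ksub_in_continuous => //; apply: slide_continuous => //.
      exact: cst_continuous.
    apply: clamp_comp; apply: realB_continuous => //.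
    by apply: realM_continuous => //; exact: ival_comp.
  + move=> l rl; rewrite rl divff ?pnatr_eq0 //.
    rewrite (_ : 2 - 1 = 1 :> R) ?clamp_ge1 //; last by lra.
    exact: cof_inE (slide_fiber (h l) (g0 l)).
- apply: mkpath_continuous => //.
  have cLI := @kify_cg (L * I)%type.
  have c1 := @kfst_continuous L I; have c2 := @ksnd_continuous L I.
  apply: path_at_comp => //; first exact: comp_continuous cg c1.
  have c1' (u : L -> I) : continuous u -> continuous (fun l : kprod L I => ival (u l.1)).
    by move=> cu; apply: ival_comp; exact: comp_continuous cu c1.
  apply: clamp_comp; apply: realD_continuous; apply: realM_continuous.
  + by apply: realB_continuous => //; exact: ival_comp.
  + apply: realM_continuous; last exact: c1'.
    apply: realB_continuous => //; apply: ival_comp; apply: clamp_comp.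
    by apply: realM_continuous => //; exact: c1'.
  + exact: ival_comp.
  + exact: c1'.
Qed.

End Contraction.

(** * Simplices and their facets *)

Section Simplex.
Variable R : realType.

Lemma realsum_continuous (L : topologicalType) (n : nat) (f : 'I_n -> L -> R) :
  (forall i, continuous (f i)) -> continuous (fun l => \sum_i f i l).
Proof.
elim: n f => [|n IH] f cf.
  rewrite (_ : (fun _ => _) = fun=> 0); first exact: cst_continuous.
  by apply/funext => l; rewrite big_ord0.
rewrite (_ : (fun _ => _) = fun l => f ord0 l + \sum_i f (lift ord0 i) l).
  by apply: realD_continuous => //; exact: IH.
by apply/funext => l; rewrite big_ord_recl.
Qed.

Lemma row_continuous (L : topologicalType) (n : nat) (f : L -> 'rV[R]_n) :
  (forall j, continuous (fun l => f l ord0 j)) -> continuous f.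
Proof.
move=> cf l U [P nP PU].
have : \forall l' \near l, forall j, P ord0 j (f l' ord0 j).
  by apply: filter_forall => j; apply: cf; exact: nP.
by apply: filterS => l' Pl'; apply: PU => a b; rewrite (ord1 a).
Qed.

Definition scoord (n : nat) (t : simplex R n) (j : 'I_n.+1) : R :=
  set_val t ord0 j.

Lemma scoord_continuous n j : continuous (fun t : simplex R n => scoord t j).
Proof.
exact: comp_continuous (@coord_continuous R 1 n.+1 ord0 j)
  (@initial_continuous _ _ _).
Qed.

Lemma scoord_ge0 n (t : simplex R n) j : 0 <= scoord t j.
Proof. by have [t0 _] := set_valP t; exact: t0. Qed.

Lemma scoord_sum n (t : simplex R n) : \sum_j scoord t j = 1.
Proof. by have [] := set_valP t. Qed.

Lemma simplex_eq n (t t' : simplex R n) : scoord t =1 scoord t' -> t = t'.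
Proof. by move=> h; apply: val_inj; apply/rowP => j; exact: h. Qed.

Lemma scoord_coface n (i j : 'I_n.+2) (t : simplex R n) :
  scoord (coface i t) j = oapp (scoord t) 0 (unlift i j).
Proof. by rewrite /scoord /coface /= mxE. Qed.

Lemma scoord_coface_same n (i : 'I_n.+2) (t : simplex R n) :
  scoord (coface i t) i = 0.
Proof. by rewrite scoord_coface unlift_none. Qed.

Lemma scoord_coface_lift n (i : 'I_n.+2) (k : 'I_n.+1) (t : simplex R n) :
  scoord (coface i t) (lift i k) = scoord t k.
Proof. by rewrite scoord_coface liftK. Qed.

Lemma coface_inj n (i : 'I_n.+2) : injective (@coface R n i).
Proof.
move=> t t' E; apply: simplex_eq => k.
by rewrite -(scoord_coface_lift i) E scoord_coface_lift.
Qed.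

Lemma simplex_compact n : compact [set: simplex R n].
Proof.
apply: set_type_compact.
apply: (@subclosed_compact _ _
  [set v : 'rV[R]_n.+1 | forall i, `[0, 1]%classic (v ord0 i)]).
- have cs (v : 'I_n.+1) := @coord_continuous R 1 n.+1 ord0 v.
  have -> : @simplex_set R n = (\bigcap_(i in [set: 'I_n.+1])
      ((fun v : 'rV[R]_n.+1 => v ord0 i) @^-1` [set x | 0 <= x])) `&`
      ((fun v : 'rV[R]_n.+1 => \sum_i v ord0 i) @^-1` [set 1]).
    apply/seteqP; split=> [v [v0 v1]|v [v0 v1]]; split=> //= i.
      by move=> _; exact: v0.
    exact: v0.
  apply: closedI.
    apply: closed_bigI => i _.
    by apply: (proj1 (continuous_closedP _) (cs i)); exact: closed_ge.
  apply: (proj1 (continuous_closedP _) (realsum_continuous cs)).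
  exact: closed_eq.
- apply: (@rV_compact R n.+1 (fun=> `[0, 1]%classic)) => _.
  exact: segment_compact.
- move=> v [v0 v1] i; rewrite /= in_itv /= v0 -v1 (bigD1 i) //= lerDl.
  exact: sumr_ge0.
Qed.

Lemma simplex_hausdorff n : hausdorff_space (simplex R n).
Proof. apply: set_type_hausdorff; exact: norm_hausdorff. Qed.

End Simplex.

Section FaceProj.
Variables (R : realType) (n : nat).
Local Notation N := (n.+2%:R : R).

(** The sets [min_at i] cover the simplex, and [min_at i] is the cone over the
    [i]-th facet with the barycentre as vertex. *)
Definition min_at (i : 'I_n.+2) (t : simplex R n.+1) : Prop :=
  forall j, scoord t i <= scoord t j.

Lemma min_atP (t : simplex R n.+1) : exists i, min_at i t.
Proof.
by case: (@arg_minP _ _ _ ord0 xpredT (scoord t) isT) => i _ h; exists i => j; exact: h.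
Qed.

Lemma min_at_closed (i : 'I_n.+2) : closed [set t | min_at i t].
Proof.
have -> : [set t | min_at i t] = \bigcap_(j in [set: 'I_n.+2])
    ((fun t => scoord t j - scoord t i) @^-1` [set x | 0 <= x]).
  apply/seteqP; split=> [t h j _|t h j]; first by rewrite /= subr_ge0; exact: h.
  by have := h j I; rewrite /= subr_ge0.
apply: closed_bigI => j _.
apply: (proj1 (continuous_closedP (fun t => scoord t j - scoord t i))).
  by apply: realB_continuous; exact: scoord_continuous.
exact: closed_ge.
Qed.

(** Zero on the boundary, and one as soon as all coordinates are at least half
    of their common value [1 / N] at the barycentre. *)
Definition depth (x : R) : R := Num.min (2 * N * x) 1.

Lemma depth_continuous : continuous depth.
Proof.
apply: realmin_continuous; last exact: cst_continuous.
by apply: realM_continuous; [exact: cst_continuous|exact: id_cont].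
Qed.

Lemma depth_le1 x : depth x <= 1.
Proof. by rewrite /depth ge_min lexx orbT. Qed.

Lemma depth_ge0 x : 0 <= x -> 0 <= depth x.
Proof. by move=> x0; rewrite /depth le_min ler01 !mulr_ge0 ?ler0n. Qed.

Lemma depth0 : depth 0 = 0.
Proof. by rewrite /depth mulr0 (min_idPl ler01). Qed.

Lemma depth_lt1 x : depth x < 1 -> depth x = 2 * N * x.
Proof. by rewrite /depth minElt; case: ifP => // _; rewrite ltxx. Qed.

Lemma depth_le x : depth x / (2 * N) <= x.
Proof.
by rewrite ler_pdivrMr ?mulr_gt0 ?ltr0n // mulrC /depth ge_min lexx.
Qed.

(** The coordinates of the projection of a point of [min_at i] to the [i]-th
    facet, where [x] is the smallest coordinate.  For depth below one this is
    the radial projection from the barycentre: subtract [x] everywhere and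
    rescale.  That projection has no limit at the barycentre, so for larger [x]
    only [1 / (2 N)] is subtracted, and the rest of the [i]-th coordinate is
    shared out among the others to keep the sum. *)
Definition face_coord (x y : R) : R :=
  (y - depth x / (2 * N) + (x - depth x / (2 * N)) / n.+1%:R) / (1 - depth x / 2).

Definition face_proj_mx (i : 'I_n.+2) (t : simplex R n.+1) : 'rV[R]_n.+1 :=
  \row_k face_coord (scoord t i) (scoord t (lift i k)).

Lemma face_proj_subproof (i : 'I_n.+2) (t : simplex R n.+1) :
  min_at i t -> simplex_set (face_proj_mx i t).
Proof.
move=> mi; have x0 := scoord_ge0 t i; set x := scoord t i in x0 *.
have d1 := depth_le1 x; have dx := depth_le x.
have D0 : 0 < 1 - depth x / 2 by lra.
split=> [k|].
  rewrite mxE /face_coord -/x divr_ge0 ?(ltW D0) // addr_ge0 //.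
    by rewrite subr_ge0 (le_trans dx) ?mi.
  by rewrite divr_ge0 ?ler0n // subr_ge0.
under eq_bigr do rewrite mxE.
rewrite /face_coord -mulr_suml -/x; apply: (canLR (mulfK (lt0r_neq0 D0))).
rewrite mul1r !big_split /= !sumr_const card_ord.
have := scoord_sum t; rewrite (bigD1_ord i) //= -/x => /(canRL (addKr x)) ->.
rewrite -[X in _ + X = _]mulr_natr divfK ?pnatr_eq0 // -[X in _ + X + _ = _]mulr_natr.
have m0 : (0 : R) <= n.+1%:R by rewrite ler0n.
rewrite (_ : n.+2%:R = n.+1%:R + 1 :> R); last by rewrite natr1.
move: (n.+1%:R) m0 (depth x) => m m0 d.
by field; lra.
Qed.

Definition face_proj (i : 'I_n.+2) (t : simplex R n.+1) (h : min_at i t) :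
    simplex R n := SigSub (mem_set (face_proj_subproof h)).

Lemma scoord_face_proj i t (h : min_at i t) k :
  scoord (face_proj h) k = face_coord (scoord t i) (scoord t (lift i k)).
Proof. by rewrite /scoord /= mxE. Qed.

Lemma face_coord_continuous (L : topologicalType) (x y : L -> R) :
  (forall l, 0 <= x l) -> continuous x -> continuous y ->
  continuous (fun l => face_coord (x l) (y l)).
Proof.
move=> x0 cx cy; have cd := comp_continuous depth_continuous cx.
have cst (r : R) : continuous ((fun=> r) : L -> R) by exact: cst_continuous.
apply: realM_continuous.
  apply: realD_continuous; first by apply: realB_continuous => //; exact: realM_continuous.
  apply: realM_continuous => //; apply: realB_continuous => //; exact: realM_continuous.
move=> l; apply: (@continuousV R L (fun l => 1 - depth (x l) / 2) l).
  by rewrite gt_eqF //; have := depth_le1 (x l); lra.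
by apply: realB_continuous => //; exact: realM_continuous.
Qed.

Lemma face_proj_continuous (L : topologicalType) (i : 'I_n.+2)
    (t : L -> simplex R n.+1) (h : forall l, min_at i (t l)) :
  continuous t -> continuous (fun l => face_proj (h l)).
Proof.
move=> ct; have cc j := comp_continuous (@scoord_continuous R n.+1 j) ct.
apply: continuous_comp_initial; apply: row_continuous => k.
rewrite (_ : (fun _ => _) = fun l => face_coord (scoord (t l) i) (scoord (t l) (lift i k))).
  by apply: face_coord_continuous => // l; exact: scoord_ge0.
by apply/funext => l; rewrite /= mxE.
Qed.

Lemma face_coord0 y : face_coord 0 y = y.
Proof. by rewrite /face_coord depth0 !mul0r !subr0 mul0r addr0 divr1. Qed.

Lemma face_proj_coface i (t : simplex R n) (h : min_at i (coface i t)) :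
  face_proj h = t.
Proof.
apply: simplex_eq => k.
by rewrite scoord_face_proj scoord_coface_same scoord_coface_lift face_coord0.
Qed.

Lemma min_at_coface i (t : simplex R n) : min_at i (coface i t).
Proof. by move=> j; rewrite scoord_coface_same scoord_ge0. Qed.

Lemma face_coord_shallow x y :
  depth x < 1 -> face_coord x y = (y - x) / (1 - depth x / 2).
Proof.
move=> dx; rewrite /face_coord; have -> : depth x / (2 * N) = x.
  by rewrite (depth_lt1 dx) mulrC mulKf // mulf_neq0 ?pnatr_eq0.
by rewrite subrr mul0r addr0.
Qed.

(** The formula for the radial projection treats all coordinates alike, whence
    it does not depend on the choice of a smallest coordinate. *)
Lemma coface_face_proj i t (h : min_at i t) (j : 'I_n.+2) :
  depth (scoord t i) < 1 ->
  scoord (coface i (face_proj h)) j = (scoord t j - scoord t i) / (1 - depth (scoord t i) / 2).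
Proof.
move=> dx; case: (unliftP i j) => [k ->|->].
  by rewrite scoord_coface_lift scoord_face_proj face_coord_shallow.
by rewrite scoord_coface_same subrr mul0r.
Qed.

Lemma min_at_eq i j t : min_at i t -> min_at j t -> scoord t i = scoord t j.
Proof. by move=> hi hj; apply/le_anti; rewrite hi hj. Qed.

Lemma coface_face_proj_eq i j t (hi : min_at i t) (hj : min_at j t) :
  depth (scoord t i) < 1 -> coface i (face_proj hi) = coface j (face_proj hj).
Proof.
move=> dx; apply: simplex_eq => k.
by rewrite !coface_face_proj // -(min_at_eq hi hj).
Qed.

End FaceProj.

(** * Filling a half-smash with a simplex *)

Section Square.
Variable R : realType.
Local Notation I := (unitI R).
Local Notation I0 := (I0 R).
Local Notation I1 := (I1 R).

(** A point of depth [d] and height [s] in the prism is moved away from the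
    centre onto the boundary, to the height [stretch d s]: at depth [1] the
    middle third of the heights is stretched over the interval, and the outer
    thirds end up at [0] or [1].  [radius] measures how far the point was from
    the boundary. *)
Definition stretch (d : R) (s : I) : I :=
  clamp (2^-1 + (ival s - 2^-1) * (1 + 2 * d)).

Definition radius (d : R) (s : I) : I :=
  clamp (Num.min d (Num.min (3 * ival s) (3 * (1 - ival s)))).

Lemma stretch_continuous (L : topologicalType) (d : L -> R) (s : L -> I) :
  continuous d -> continuous s -> continuous (fun l => stretch (d l) (s l)).
Proof.
move=> cd cs; have cst (r : R) : continuous ((fun=> r) : L -> R).
  exact: cst_continuous.
apply: clamp_comp; apply: realD_continuous => //; apply: realM_continuous.
  by apply: realB_continuous => //; exact: ival_comp.
by apply: realD_continuous => //; exact: realM_continuous.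
Qed.

Lemma radius_continuous (L : topologicalType) (d : L -> R) (s : L -> I) :
  continuous d -> continuous s -> continuous (fun l => radius (d l) (s l)).
Proof.
move=> cd cs; have cst (r : R) : continuous ((fun=> r) : L -> R).
  exact: cst_continuous.
have ci := ival_comp cs.
apply: clamp_comp; apply: realmin_continuous => //; apply: realmin_continuous.
  exact: realM_continuous.
by apply: realM_continuous => //; exact: realB_continuous.
Qed.

Lemma stretch0 s : stretch 0 s = s.
Proof. by rewrite /stretch mulr0 addr0 mulr1 addrC subrK clamp_ival. Qed.

Lemma radius0 s : radius 0 s = I0.
Proof. by rewrite /radius clamp_le0 // ge_min lexx. Qed.

Lemma stretch_I0 d : 0 <= d -> stretch d I0 = I0.
Proof. by move=> d0; rewrite /stretch ival0 clamp_le0 //; nra. Qed.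

Lemma stretch_I1 d : 0 <= d -> stretch d I1 = I1.
Proof. by move=> d0; rewrite /stretch ival1 clamp_ge1 //; nra. Qed.

Lemma radius_I0 d : radius d I0 = I0.
Proof. by rewrite /radius clamp_le0 // !ge_min ival0 mulr0 lexx orbT. Qed.

Lemma radius_I1 d : radius d I1 = I0.
Proof. by rewrite /radius clamp_le0 // !ge_min ival1 subrr mulr0 lexx !orbT. Qed.

(** Where the projection to the facets is ambiguous, either the boundary point
    is on an end of the prism or the contraction is complete. *)
Lemma prism_deep s :
  [\/ stretch 1 s = I0, stretch 1 s = I1 | radius 1 s = I1].
Proof.
have [s1|s1] := leP (3 * ival s) 1; first by apply: Or31; rewrite /stretch clamp_le0 //; lra.
have [s2|s2] := leP 2 (3 * ival s); first by apply: Or32; rewrite /stretch clamp_ge1 //; lra.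
by apply: Or33; rewrite /radius clamp_ge1 // !le_min lexx (ltW s1) /=; lra.
Qed.

End Square.

Section Extension.
Variables (R : realType) (A X : cgSpace) (q : cgMap A X).
Local Notation I := (unitI R).
Local Notation I0 := (I0 R).
Local Notation I1 := (I1 R).
Local Notation G := (fib_space R q).
Local Notation p := (fib_map R q).
Local Notation p' := (fiber_cofiber_map R p).
Local Notation G' := (fib_space R p').

Lemma contract_congr (e e' : G) (g : paths R X) (s s' t r r' : I)
    (h : p e = path_at g s) (h' : p e' = path_at g s')
    (g0 g0' : path_at g I0 = cg_pt X) :
  e = e' -> s = s' -> r = r' -> contract h g0 t r = contract h' g0' t r'.
Proof.
move=> Ee Es Er; subst e' s' r'.
by rewrite (Prop_irrelevance h h') (Prop_irrelevance g0 g0').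
Qed.

Lemma contract_top (e e' : G) (g : paths R X) (s s' t r r' : I)
    (h : p e = path_at g s) (h' : p e' = path_at g s')
    (g0 : path_at g I0 = cg_pt X) :
  r = I1 -> r' = I1 -> contract h g0 t r = contract h' g0 t r'.
Proof. by move=> -> ->; exact: contract1. Qed.

Lemma contract_bottom (e : G) (g : paths R X) (s t r : I)
    (h : p e = path_at g s) (g0 : path_at g I0 = cg_pt X) :
  e = cg_pt G -> s = t -> r = I0 -> contract h g0 t r = cg_pt G'.
Proof. by move=> Ee Es Er; subst e s r; rewrite contract0 cgmap_pt. Qed.

Variables (B : cgSpace) (n : nat).
Local Notation S := (susp R B).
Local Notation D := (simplex R n).
Local Notation D' := (simplex R n.+1).

Definition susp_pi (b : B) (s : I) : S := prod_pi (@susp_set R B) (cg_pt B, I0) b s.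

Lemma susp_pi_base b s : @susp_set R B (b, s) -> susp_pi b s = cg_pt S.
Proof. by move=> bs; apply: glue_pi_eq; split => //; exact: Or31. Qed.

Lemma susp_pi_comp (L : topologicalType) (b : L -> B) (s : L -> I) :
  compactly_generated L -> continuous b -> continuous s ->
  continuous (fun l => susp_pi (b l) (s l)).
Proof. exact: prod_pi_comp. Qed.

Definition hsmash_pi (Y : cgSpace) m (x : Y) (t : simplex R m) : hsmash Y (vertex R m) :=
  prod_pi (@hsmash_set Y (simplex R m)) (cg_pt Y, vertex R m) x t.

Lemma hsmash_pi_base (Y : cgSpace) m (t : simplex R m) : hsmash_pi (cg_pt Y) t = cg_pt _.
Proof. exact: glue_pi_eq. Qed.

Variables (g : cgMap S X) (h : 'I_n.+2 -> cgMap (hsmash S (vertex R n)) G).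
Hypothesis hg : forall i z, p (h i z) = g (hsmash_pr S (vertex R n) z).
Hypothesis hh : forall i j x t t', coface i t = coface j t' ->
  h i (hsmash_pi x t) = h j (hsmash_pi x t').

Lemma ray_cont (b : B) : continuous (fun u => g (susp_pi b u)).
Proof.
apply: comp_continuous; first exact: cgmap_cont.
have cI := compact_hausdorff_cg (@unitI_compact R) (@unitI_hausdorff R).
by apply: susp_pi_comp => //; [exact: cst_continuous|exact: id_cont].
Qed.

Definition ray (b : B) : paths R X := mkpath (@ray_cont b).

Lemma ray_continuous : continuous ray.
Proof.
apply: mkpath_continuous; first exact: cg_gen.
apply: comp_continuous; first exact: cgmap_cont.
apply: susp_pi_comp; [exact: kify_cg|exact: kfst_continuous|exact: ksnd_continuous].
Qed.

Lemma ray0 b : path_at (ray b) I0 = cg_pt X.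
Proof. by rewrite -[LHS]/(g (susp_pi b I0)) susp_pi_base ?cgmap_pt //; exact: Or32. Qed.

Lemma ray_base : ray (cg_pt B) = cst_path R (cg_pt X).
Proof.
apply: path_eq => u; rewrite -[LHS]/(g (susp_pi (cg_pt B) u)) susp_pi_base ?cgmap_pt //.
exact: Or31.
Qed.

Definition wall i (b : B) (s : I) (t : D) : G := h i (hsmash_pi (susp_pi b s) t).

Lemma wall_base i b s t : @susp_set R B (b, s) -> wall i b s t = cg_pt G.
Proof. by move=> bs; rewrite /wall susp_pi_base // hsmash_pi_base cgmap_pt. Qed.

Lemma wallP i b s t : p (wall i b s t) = path_at (ray b) s.
Proof. by rewrite /wall hg hsmash_prE. Qed.

Definition fill_at (i : 'I_n.+2) (b : B) (s : I) (t : D') (ti : min_at i t) : G' :=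
  let d := depth n (scoord t i) in
  contract (wallP i b (stretch d s) (face_proj ti)) (ray0 b) s (radius d s).

(** At depth below one the projections to the two facets agree in the simplex;
    at depth one [prism_deep] applies. *)
Lemma fill_at_indep i j b s t (ti : min_at i t) (tj : min_at j t) :
  fill_at b s ti = fill_at b s tj.
Proof.
rewrite /fill_at; have Ed : scoord t i = scoord t j := min_at_eq ti tj.
have [d1|d1] := ltP (depth n (scoord t i)) 1.
  apply: contract_congr; rewrite -?Ed //.
  exact/hh/coface_face_proj_eq.
have dE : depth n (scoord t i) = 1 by apply/le_anti; rewrite depth_le1.
have dE' : depth n (scoord t j) = 1 by rewrite -Ed.
have wI s' (t1 t2 : D) : s' = I0 \/ s' = I1 -> wall i b s' t1 = wall j b s' t2.
  by case=> ->; rewrite !wall_base //; first [exact: Or32|exact: Or33].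
have [sE|sE|rE] := prism_deep s.
- by apply: contract_congr; rewrite dE dE' //; apply: wI; left.
- by apply: contract_congr; rewrite dE dE' //; apply: wI; right.
- by apply: contract_top; rewrite ?dE ?dE'.
Qed.

Definition fill (b : B) (s : I) (t : D') : G' :=
  fill_at b s (projT2 (cid (min_atP t))).

Lemma fillE i b s t (ti : min_at i t) : fill b s t = fill_at b s ti.
Proof. exact: fill_at_indep. Qed.

Lemma fill_map b s t : fib_map R p' (fill b s t) = g (susp_pi b s).
Proof. exact: contract_map. Qed.

(** Over the base point of [B] the ray is constant, and the contraction does not
    leave the base point; at the ends of the prism [radius] vanishes, so that
    nothing is contracted. *)
Lemma fill_base b s t : @susp_set R B (b, s) -> fill b s t = cg_pt G'.
Proof.
move=> bs; have [i ti] := min_atP t; rewrite (fillE _ _ ti) /fill_at.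
have d0 : 0 <= depth n (scoord t i) by apply: depth_ge0; exact: scoord_ge0.
have {bs}[E|E|E] : [\/ b = cg_pt B, s = I0 | s = I1] := bs; subst.
- apply: contract_base; first by apply: wall_base; exact: Or31.
  exact: ray_base.
- apply: contract_bottom; rewrite ?stretch_I0 ?radius_I0 //.
  by apply: wall_base; exact: Or32.
- apply: contract_bottom; rewrite ?stretch_I1 ?radius_I1 //.
  by apply: wall_base; exact: Or33.
Qed.

Lemma fill_face i b s (t : D) :
  fill b s (coface i t) = ganea_incl R q (wall i b s t).
Proof.
rewrite (fillE b s (@min_at_coface R n i t)) /fill_at.
rewrite -(contract0 (wallP i b s t) (ray0 b)); apply: contract_congr.
- by rewrite face_proj_coface scoord_coface_same depth0 stretch0.
- by rewrite scoord_coface_same depth0 stretch0.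
- by rewrite scoord_coface_same depth0 radius0.
Qed.

Lemma fill_continuous (L : topologicalType) (b : L -> B) (s : L -> I) (t : L -> D') :
  compactly_generated L -> continuous b -> continuous s -> continuous t ->
  continuous (fun l => fill (b l) (s l) (t l)).
Proof.
move=> cL cb cs ct.
apply: (@closed_cover_continuous _ L G' (fun i => t @^-1` [set t | min_at i t])) => //.
- by move=> i; apply: (proj1 (continuous_closedP t) ct); exact: min_at_closed.
- by move=> l; have [i] := min_atP (t l); exists i.
move=> i; set L' := ksub _.
have cL' : compactly_generated L' by exact: kify_cg.
have ti (l : L') : min_at i (t (ksub_val l)) by exact: (ksub_valP l).
rewrite (_ : (fun _ => _) =
  fun l : L' => fill_at (b (ksub_val l)) (s (ksub_val l)) (ti l)); last first.
  by apply/funext => l; exact: fillE.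
have cv : continuous (@ksub_val _ _ : L' -> L) by exact: ksub_val_continuous.
have {}cb := comp_continuous cb cv; have {}cs := comp_continuous cs cv.
have {}ct := comp_continuous ct cv.
have cd : continuous (fun l : L' => depth n (scoord (t (ksub_val l)) i)).
  apply: comp_continuous (@depth_continuous R n) _.
  exact: comp_continuous (@scoord_continuous R n.+1 i) ct.
have cst := stretch_continuous cd cs.
apply: contract_continuous => //.
- apply: comp_continuous; first exact: cgmap_cont.
  apply: prod_pi_comp => //; first exact: susp_pi_comp.
  exact: face_proj_continuous.
- exact: comp_continuous ray_continuous cb.
- exact: radius_continuous.
Qed.

Definition fill_susp (x : S) (t : D') : G' :=
  @prod_mod_fun B I (@susp_set R B) (cg_pt B, I0) G' (fun b s => fill b s t) x.

Lemma fill_suspE b s t : fill_susp (susp_pi b s) t = fill b s t.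
Proof.
by apply: (@prod_mod_recE B I (@susp_set R B) (cg_pt B, I0) G' (fun b s => fill b s t))
  => -[b1 s1]; exact: fill_base.
Qed.

Lemma fill_susp_continuous : continuous (kuncurry fill_susp).
Proof.
apply: glue_kprod_continuous; first exact: kify_cg.
- exact: simplex_compact.
- exact: simplex_hausdorff.
rewrite (_ : kuncurry _ = fun l : kprod (kprod B I) D' => fill l.1.1 l.1.2 l.2); last first.
  by apply/funext => -[[b s] t]; exact: fill_suspE.
have c1 := @kfst_continuous (kprod B I) D'.
apply: fill_continuous; first exact: kify_cg.
- exact: comp_continuous (@kfst_continuous B I) c1.
- exact: comp_continuous (@ksnd_continuous B I) c1.
- exact: ksnd_continuous.
Qed.

Lemma fill_susp_base t : fill_susp (cg_pt S) t = cg_pt G'.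
Proof.
rewrite -(@susp_pi_base (cg_pt B) I0); last exact: Or31.
by rewrite fill_suspE fill_base //; exact: Or31.
Qed.

Lemma fill_susp_compat (x : (S * D')%type) :
  hsmash_set x -> fill_susp x.1 x.2 = cg_pt G'.
Proof. by rewrite /hsmash_set => xE; rewrite [x.1]xE fill_susp_base. Qed.

Definition filler : cgMap (hsmash S (vertex R n.+1)) G' :=
  @prod_mod_rec S D' (@hsmash_set S D') (cg_pt S, vertex R n.+1) G' fill_susp
    fill_susp_compat (fill_susp_base _) fill_susp_continuous.

Lemma fillerE x t : filler (hsmash_pi x t) = fill_susp x t.
Proof.
exact: (@prod_mod_recE S D' (@hsmash_set S D') (cg_pt S, vertex R n.+1) G' fill_susp
  fill_susp_compat x t).
Qed.

Lemma filler_map z : fib_map R p' (filler z) = g (hsmash_pr S (vertex R n.+1) z).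
Proof.
have [x [t <-]] := prod_pi_surj z; rewrite -/(hsmash_pi x t) fillerE hsmash_prE.
by have [b [s <-]] := prod_pi_surj x; rewrite -/(susp_pi b s) fill_suspE fill_map.
Qed.

Lemma filler_face i z :
  filler (hsmash_map (vertex R n) (vertex R n.+1) (pid S) (@coface_continuous R n i) z)
  = ganea_incl R q (h i z).
Proof.
have [x [t <-]] := prod_pi_surj z.
rewrite prod_mod_mapE -/(hsmash_pi x t) -/(hsmash_pi _ (coface i t)).
rewrite fillerE; have [b [s <-]] := prod_pi_surj x.
by rewrite -/(susp_pi b s) fill_suspE fill_face.
Qed.

End Extension.

(** * Realizations and the lift *)

Lemma pushout_cases (A B : cgSpace) (C : Type) (f : C -> A) (g : C -> B)
    (z : pushout f g) :
  (exists a, po1 f g a = z) \/ (exists b, po2 f g b = z).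
Proof.
by have [[[] y] <-] := glue_pi_surj z; [left|right]; exists y.
Qed.

Section Facets.
Variable R : realType.

Lemma coface_coface n (i j : 'I_n.+2) (t : simplex R n) : (i <= j)%N ->
  coface (lift ord0 j) (coface i t) =
  coface (widen_ord (leqnSn _) i) (coface j t).
Proof.
move=> ij; apply: simplex_eq => k.
case: (unliftP (lift ord0 j) k) => [k1 ->|->]; last first.
  rewrite scoord_coface_same.
  have -> : lift ord0 j = lift (widen_ord (leqnSn _) i) j.
    by apply: val_inj; rewrite /= /bump leq0n ij.
  by rewrite scoord_coface_lift scoord_coface_same.
rewrite scoord_coface_lift; case: (unliftP i k1) => [k2 ->|->].
  rewrite scoord_coface_lift.
  have -> : lift (lift ord0 j) (lift i k2) =
      lift (widen_ord (leqnSn _) i) (lift j k2).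
    by apply: val_inj; rewrite /= /bump; lia.
  by rewrite !scoord_coface_lift.
rewrite scoord_coface_same.
have -> : lift (lift ord0 j) i = widen_ord (leqnSn _) i.
  by apply: val_inj; rewrite /= /bump; lia.
by rewrite scoord_coface_same.
Qed.

(** The projection to a facet fixes the points of that facet. *)
Lemma coface_of_coord0 n (i : 'I_n.+2) (t : simplex R n.+1) :
  scoord t i = 0 -> exists t', t = coface i t'.
Proof.
move=> ti; have mi : min_at i t by move=> j; rewrite ti scoord_ge0.
exists (face_proj mi); apply: simplex_eq => j; rewrite coface_face_proj ti depth0 ?ltr01 //.
by rewrite mul0r !subr0 divr1.
Qed.

Variable F : facialSpace.

Lemma hface_pi m n (i : 'I_m.+2) (x : F m.+1) (t : simplex R n) :
  hface R F n i (hsmash_pi x t) = hsmash_pi (fs_d i x) t.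
Proof. exact: prod_mod_mapE. Qed.

Lemma hcoface_pi m n (i : 'I_n.+2) (x : F m) (t : simplex R n) :
  hcoface R F m i (hsmash_pi x t) = hsmash_pi x (coface i t).
Proof. exact: prod_mod_mapE. Qed.

Lemma chi_coface n (i : 'I_n.+2) (x : F n.+1) (t : simplex R n) :
  chi R F n.+1 (hsmash_pi x (coface i t)) =
  realization_inc R F n (chi R F n (hsmash_pi (fs_d i x) t)).
Proof.
have := po_glue (facet_att (chi R F n)) (@facet_inc R F n) (i, hsmash_pi x t).
rewrite -[facet_att _ _]/(chi R F n (hface R F n i (hsmash_pi x t))).
rewrite -[facet_inc _]/(hcoface R F n.+1 i (hsmash_pi x t)) hface_pi hcoface_pi.
exact: esym.
Qed.

(** A common point of the facets [i] and [j] lies in a face of codimension two,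
    where both values are the image of one point of [||F||_(n-1)] because of
    the facial identity.  In [Delta^1] the two facets are disjoint. *)
Lemma chi_facet_lt n (i j : 'I_n.+2) (x : F n.+1) (t t' : simplex R n) :
  (i < j)%N -> coface i t = coface j t' ->
  chi R F n (hsmash_pi (fs_d i x) t) = chi R F n (hsmash_pi (fs_d j x) t').
Proof.
case: n i j x t t' => [|n] i j x t t' ij tt'.
  have [i0 j1] : i = ord0 /\ j = ord_max.
    by split; apply: val_inj; case: i j ij {tt'} => [i hi] [j hj] /=; lia.
  have /(congr1 (fun t => scoord t ord0)) := tt'.
  have {2}-> : ord0 = lift j ord0 by apply: val_inj; rewrite j1.
  rewrite scoord_coface_lift i0 scoord_coface_same => t'0.
  by have := scoord_sum t'; rewrite big_ord1 -t'0 => /eqP; rewrite eq_sym oner_eq0.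
have [j0 Ej] : exists j0, j = lift ord0 j0.
  by case: (unliftP ord0 j) => [j0 ->|jE]; [exists j0|move: ij; rewrite jE].
have hi : (i < n.+2)%N by have := ltn_ord j; lia.
pose i0 := Ordinal hi; have Ei : i = widen_ord (leqnSn _) i0 by exact: val_inj.
have ij0 : (i0 <= j0)%N by move: ij; rewrite Ej /= /bump; lia.
(* The coordinate [i0] of [t'] is the coordinate [i = lift j i0] of the common
   point, which is zero on the facet [i]. *)
have [t'' Et'] : exists t'', t' = coface i0 t''.
  apply: coface_of_coord0; rewrite -(scoord_coface_lift j) -tt'.
  rewrite (_ : lift j i0 = i) ?scoord_coface_same //.
  by apply: val_inj; rewrite /= /bump; lia.
have Et : t = coface j0 t''.
  by apply: (@coface_inj R _ i); rewrite tt' Et' Ej Ei coface_coface.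
by rewrite Et Et' !chi_coface Ei Ej fs_dd.
Qed.

Lemma chi_facet n (i j : 'I_n.+2) (x : F n.+1) (t t' : simplex R n) :
  coface i t = coface j t' ->
  chi R F n (hsmash_pi (fs_d i x) t) = chi R F n (hsmash_pi (fs_d j x) t').
Proof.
move=> tt'; case: (ltngtP i j) => [ij|ij|/val_inj ij].
- exact: chi_facet_lt.
- by apply: esym; apply: chi_facet_lt.
- by subst j; rewrite (coface_inj tt').
Qed.

End Facets.

Section Lift.
Variables (R : realType) (X : cgSpace).

(** [slide] prolongs the path that a point of an associated fibration carries,
    so the Ganea maps have to be exhibited as such fibrations. *)
Lemma ganea_from1_fib n : exists (A : cgSpace) (q : cgMap A X),
  ganea_from1 R X n = existT (fun G => cgMap G X) (fib_space R q) (fib_map R q).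
Proof.
case: n => [|n]; first by exists (so R X), (ev R X).
by exists (fiber_cofiber R (projT2 (ganea_from1 R X n))),
  (fiber_cofiber_map R (projT2 (ganea_from1 R X n))).
Qed.

Definition has_lift (Y G : cgSpace) (c : cgMap Y X) (p : cgMap G X) : Prop :=
  exists s : cgMap Y G, forall z, p (s z) = c z.

Lemma fib_has_lift (A : cgSpace) (q : cgMap A X) : has_lift q (fib_map R q).
Proof.
pose h (a : A) : path_at (cst_path R (q a)) (I0 R) = q a := erefl.
have cs : continuous (fun a => mkfib (h a)).
  apply: mkfib_continuous; [exact: cg_gen|exact: id_cont|].
  apply: mkpath_continuous; first exact: cg_gen.
  exact: comp_continuous (@cgmap_cont _ _ q) (@kfst_continuous _ _).
have ps : mkfib (h (cg_pt A)) = cg_pt (fib_space R q).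
  by apply: fib_eq => //; apply: path_eq => v; exact: cgmap_pt.
by exists (PMap cs ps).
Qed.

Local Notation L := (Lambda R X).

(** On [||Lambda X||_n] the new lift is the old one followed by the inclusion into
    the next Ganea space, and on [Lambda_(n+1) X >< Delta^(n+1)] it is [filler]. *)
Lemma lift_step (A : cgSpace) (q : cgMap A X) n :
  has_lift (canonical_map R L n) (fib_map R q) ->
  has_lift (canonical_map R L n.+1)
    (fib_map R (fiber_cofiber_map R (fib_map R q))).
Proof.
move=> [s sE].
pose h (i : 'I_n.+2) := pcomp s (pcomp (chi R L n) (hface R L n i)).
pose g : cgMap (L n.+1) X := aug_iter L n.+1.
have hg i z : fib_map R q (h i z) = g (hsmash_pr (L n.+1) (vertex R n) z).
  rewrite -[LHS]/(fib_map R q (s (chi R L n (hface R L n i z)))).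
  by rewrite sE canonical_chi hsmash_map_pr aug_iter_d.
have hh i j x (t t' : simplex R n) : coface i t = coface j t' ->
    h i (hsmash_pi x t) = h j (hsmash_pi x t').
  move=> tt'; rewrite -[LHS]/(s (chi R L n (hface R L n i (hsmash_pi x t)))).
  rewrite -[RHS]/(s (chi R L n (hface R L n j (hsmash_pi x t')))).
  by rewrite !hface_pi (chi_facet _ tt').
have compat c : pcomp (ganea_incl R q) s (facet_att (chi R L n) c) =
    filler hg hh (facet_inc c).
  by case: c => i z; exact: esym (filler_face hg hh i z).
exists (pushout_rec compat : cgMap (realization R L n.+1) _) => z.
have [[y <-]|[y <-]] := pushout_cases z.
  apply: (etrans (congr1 _ (pushout_rec1 compat y))).
  exact: etrans (sE y) (esym (@canonical_inc R X L n y)).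
apply: (etrans (congr1 _ (pushout_rec2 compat y))).
exact: etrans (filler_map hg hh y) (esym (@canonical_chi R X L n.+1 y)).
Qed.

Lemma canonical_lift n :
  has_lift (canonical_map R L n) (projT2 (ganea_from1 R X n)).
Proof.
elim: n => [|n IH]; first exact: fib_has_lift.
move: IH; rewrite /=; have [A [q ->]] := ganea_from1_fib n.
exact: lift_step.
Qed.

End Lift.

Theorem theorem3 (R : realType) (X : cgSpace) (X_Top : in_Top R X)
    (n : nat) (n_ge1 : (1 <= n)%N) :
  exists s : cgMap (realization R (Lambda R X) n.-1) (ganea R X n),
    forall z : realization R (Lambda R X) n.-1,
      ganea_map R X n (s z) = canonical_map R (Lambda R X) n.-1 z.
Proof. exact: canonical_lift. Qed.
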